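(* Let $H$ be a coquasi-Hopf algebra, $A$ a right $H$-comodule algebra and $B=A^{coH}$ the subalgebra of coinvariants. The following statements are equivalent: (1) The extension $B\subseteq A$ is cleft; (2) There exist a weak action of $H$ on $B$ and a convolution invertible cocycle $\sigma:H\otimes H\to B$ such that $A$ is isomorphic, as left $B$-module and right $H$-comodule algebra, to the crossed product $B\overline{\#}_{\sigma}H$.
   Context: All vector spaces, algebras and tensor products are over a fixed field $\Bbbk$; Sweedler notation is used: $\Delta(h)=h_1\otimes h_2$, $\rho(a)=a_0\otimes a_1$. Coquasi-bialgebra: a coassociative counital coalgebra $(H,\Delta,\varepsilon)$ with coalgebra morphisms $m:H\otimes H\to H$ (written $h\otimes g\mapsto hg$) and $u:\Bbbk\to H$ (with $u(1)=1_H$), and a convolution invertible $\omega\in(H\otimes H\otimes H)^*$ such that for all $h,g,k,l\in H$: $h_1(g_1k_1)\omega(h_2,g_2,k_2)=\omega(h_1,g_1,k_1)(h_2g_2)k_2$; $1_Hh=h1_H=h$; $\omega(h_1,g_1,k_1l_1)\omega(h_2g_2,k_2,l_2)=\omega(g_1,k_1,l_1)\omega(h_1,g_2k_2,l_2)\omega(h_2,g_3,k_3)$; $\omega(h,1_H,g)=\varepsilon(h)\varepsilon(g)$. Coquasi-Hopf algebra: a coquasi-bialgebra $H$ with a coalgebra antihomomorphism $S:H\to H$ and $\alpha,\beta\in H^*$ such that $S(h_1)\alpha(h_2)h_3=\alpha(h)1_H$, $h_1\beta(h_2)S(h_3)=\beta(h)1_H$, and $\omega(h_1,S(h_3),h_5)\beta(h_2)\alpha(h_4)=\omega^{-1}(S(h_1),h_3,S(h_5))\alpha(h_2)\beta(h_4)=\varepsilon(h)$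 for all $h\in H$. One assumes, after rescaling, $\alpha(1_H)=\beta(1_H)=1$. Right $H$-comodule algebra: a right $H$-comodule $(A,\rho_A)$ with an $H$-colinear multiplication ($\rho_A(ab)=a_0b_0\otimes a_1b_1$) and an $H$-colinear two-sided unit $1_A$ ($\rho_A(1_A)=1_A\otimes 1_H$), such that $(ab)c=a_0(b_0c_0)\,\omega(a_1,b_1,c_1)$ for all $a,b,c\in A$. $A^{coH}=\{a\in A:\rho_A(a)=a\otimes 1_H\}$ is an associative unital algebra, and $A$ is a left $B$-module by multiplication. Cleft: $B\subseteq A$ is cleft if there are a right $H$-colinear map $\gamma:H\to A$ (i.e. $\rho_A\gamma(h)=\gamma(h_1)\otimes h_2$) and a linear map $\delta:H\to A$ such that for all $h\in H$: $\rho_A(\delta(h))=\delta(h_2)\otimes S(h_1)$, $\delta(h_1)\gamma(h_2)=\alpha(h)1_A$, $\gamma(h_1)\beta(h_2)\delta(h_3)=\varepsilon(h)1_A$. Crossed product: a weak action of $H$ on $B$ and a cocycle $\sigma$ form an $H$-crossed system $(B,\cdot,\sigma)$, meaning a bilinear map $\cdot:H\otimes B\to B$ and a linear map $\sigma:H\otimes H\to B$ such that for all $h,g,l\in H$, $r,s\in B$: $h\cdot(rs)=(h_1\cdot r)(h_2\cdot s)$, $h\cdot 1=\varepsilon(h)1$, $1_H\cdot r=r$, $[h_1\cdot(g_1\cdot r)]\sigma(h_2,g_2)=\sigma(h_1,g_1)[(h_2g_2)\cdot r]$, $\sigma(h,1_H)=\sigma(1_H,h)=\varepsilon(h)1$,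 $[h_1\cdot\sigma(g_1,l_1)]\sigma(h_2,g_2l_2)=\sigma(h_1,g_1)\sigma(h_2g_2,l_1)\omega^{-1}(h_3,g_3,l_2)$. Then $B\overline{\#}_{\sigma}H=B\otimes H$ with multiplication $(r\overline{\#}_{\sigma}h)(s\overline{\#}_{\sigma}g)=r(h_1\cdot s)\sigma(h_2,g_1)\overline{\#}_{\sigma}h_3g_2$, unit $1\overline{\#}_{\sigma}1_H$ and coaction $I_B\otimes\Delta$ is a right $H$-comodule algebra, with left $B$-action by multiplication on the first factor. *)

(* Defs.v *)
From HB Require Import structures.
From mathcomp Require Import all_boot all_algebra generic_quotient boolp.

Set Implicit Arguments.
Unset Strict Implicit.
Unset Printing Implicit Defensive.

Import GRing.Theory.
Local Open Scope ring_scope.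
Local Open Scope quotient_scope.

(* A list of pairs [:: (v1, w1); ...; (vn, wn)] stands for the formal sum
   v1 (x) w1 + ... + vn (x) wn; [tens_eq] is the least congruence for
   concatenation that makes (v, w) |-> [:: (v, w)] bilinear.  The last
   constructor cannot be dropped: a monoid congruence does not derive it
   from additivity. *)
Inductive tens_eq (k : fieldType) (V W : lmodType k) :
    seq (V * W) -> seq (V * W) -> Prop :=
| TensRefl s : tens_eq s s
| TensSym s t : tens_eq s t -> tens_eq t s
| TensTrans s t u : tens_eq s t -> tens_eq t u -> tens_eq s u
| TensCat s s' t t' : tens_eq s s' -> tens_eq t t' -> tens_eq (s ++ t) (s' ++ t')
| TensComm s t : tens_eq (s ++ t) (t ++ s)
| TensDl v v' w : tens_eq [:: (v + v', w)] [:: (v, w); (v', w)]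
| TensDr v w w' : tens_eq [:: (v, w + w')] [:: (v, w); (v, w')]
| TensZ (c : k) v w : tens_eq [:: (c *: v, w)] [:: (v, c *: w)]
| Tens0 w : tens_eq [:: (0, w)] [::].

Section Tensor.
Variables (k : fieldType) (V W : lmodType k).
Implicit Types (s t : seq (V * W)) (c : k).

Definition tens_eqb s t : bool := `[< tens_eq s t >].

Lemma tens_eqb_refl : reflexive tens_eqb.
Proof. by move=> s; apply/asboolP; exact: TensRefl. Qed.

Lemma tens_eqb_sym : symmetric tens_eqb.
Proof. by move=> s t; apply/asboolP/asboolP; exact: TensSym. Qed.

Lemma tens_eqb_trans : transitive tens_eqb.
Proof.
by move=> t s u /asboolP st /asboolP tu; apply/asboolP; exact: TensTrans st tu.
Qed.

Canonical tens_equiv := EquivRel tens_eqb tens_eqb_refl tens_eqb_sym tens_eqb_trans.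

Definition tensor := {eq_quot tens_equiv}.

HB.instance Definition _ := Choice.on tensor.
Definition formal_sum s : tensor := \pi_{eq_quot tens_equiv} s.
Definition summands (x : tensor) : seq (V * W) := repr (x : {eq_quot tens_equiv}).

Lemma summandsK : cancel summands formal_sum.
Proof. exact: reprK. Qed.

Lemma formal_sumP s t : reflect (tens_eq s t) (formal_sum s == formal_sum t).
Proof. by rewrite [_ == _]eqmodE; exact: asboolP. Qed.

Lemma formal_sum_eq s t : tens_eq s t -> formal_sum s = formal_sum t.
Proof. by move=> st; apply/eqP/formal_sumP. Qed.

Lemma summands_formal_sum s : tens_eq (summands (formal_sum s)) s.
Proof. by apply/formal_sumP; rewrite summandsK. Qed.

Definition tens_add (x y : tensor) : tensor := formal_sum (summands x ++ summands y).
Definition tens_scale_seq c s := [seq (c *: p.1, p.2) | p <- s].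
Definition tens_scale c (x : tensor) : tensor := formal_sum (tens_scale_seq c (summands x)).
Definition tens_zero : tensor := formal_sum [::].
Definition tens_opp : tensor -> tensor := tens_scale (-1).

Lemma tens_scale_seq_eq c s t :
  tens_eq s t -> tens_eq (tens_scale_seq c s) (tens_scale_seq c t).
Proof.
rewrite /tens_scale_seq; elim=> {s t} //=.
- by move=> s; exact: TensRefl.
- by move=> s t _; exact: TensSym.
- by move=> s t u _ st _; exact: TensTrans.
- by move=> s s' t t' _ ss' _ tt'; rewrite !map_cat; exact: TensCat.
- by move=> s t; rewrite !map_cat; exact: TensComm.
- by move=> v v' w; rewrite scalerDr; exact: TensDl.
- by move=> v w w'; exact: TensDr.
- by move=> d v w; rewrite scalerA mulrC -scalerA; exact: TensZ.
- by move=> w; rewrite scaler0; exact: Tens0.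
Qed.

Lemma tens_addE s t : tens_add (formal_sum s) (formal_sum t) = formal_sum (s ++ t).
Proof. by apply: formal_sum_eq; apply: TensCat; exact: summands_formal_sum. Qed.

Lemma tens_scaleE c s : tens_scale c (formal_sum s) = formal_sum (tens_scale_seq c s).
Proof. by apply: formal_sum_eq; apply: tens_scale_seq_eq; exact: summands_formal_sum. Qed.

Lemma formal_sum_ind (P : tensor -> Prop) : (forall s, P (formal_sum s)) -> forall x, P x.
Proof. by move=> Ppi x; rewrite -[x]summandsK. Qed.

Lemma tens_addA : associative tens_add.
Proof.
elim/formal_sum_ind=> s; elim/formal_sum_ind=> t; elim/formal_sum_ind=> u.
by rewrite !tens_addE catA.
Qed.

Lemma tens_addC : commutative tens_add.
Proof.
elim/formal_sum_ind=> s; elim/formal_sum_ind=> t.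
by rewrite !tens_addE; apply: formal_sum_eq; exact: TensComm.
Qed.

Lemma tens_add0 : left_id tens_zero tens_add.
Proof. by elim/formal_sum_ind=> s; rewrite tens_addE. Qed.

Lemma tens_scaleDl_seq c d s :
  tens_eq (tens_scale_seq (c + d) s) (tens_scale_seq c s ++ tens_scale_seq d s).
Proof.
elim: s => [|[v w] s IHs] /=; first exact: TensRefl.
rewrite -cat1s; apply: TensTrans (TensCat (TensRefl _) IHs) _ => /=.
rewrite scalerDl -cat1s.
apply: TensTrans (TensCat (TensDl _ _ _) (TensRefl _)) _ => /=.
rewrite -cat1s -[X in tens_eq _ X]cat1s; apply: TensCat; first exact: TensRefl.
rewrite -[X in tens_eq X _]cat1s -[in X in tens_eq _ X]cat1s !catA.
by apply: TensCat; [exact: TensComm | exact: TensRefl].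
Qed.

Lemma tens_scaleDl x c d :
  tens_scale (c + d) x = tens_add (tens_scale c x) (tens_scale d x).
Proof.
elim/formal_sum_ind: x => s; rewrite !tens_scaleE tens_addE.
by apply: formal_sum_eq; exact: tens_scaleDl_seq.
Qed.

Lemma tens_scale0 x : tens_scale 0 x = tens_zero.
Proof.
elim/formal_sum_ind: x => s; rewrite tens_scaleE; apply: formal_sum_eq.
elim: s => [|[v w] s IHs] /=; first exact: TensRefl.
by rewrite -cat1s -[[::]]/([::] ++ [::]) scale0r; apply: TensCat IHs; exact: Tens0.
Qed.

Lemma tens_scale1 : left_id 1 tens_scale.
Proof.
elim/formal_sum_ind=> s; rewrite tens_scaleE; congr (formal_sum _).
by rewrite /tens_scale_seq -[RHS]map_id; apply: eq_map => -[v w] /=; rewrite scale1r.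
Qed.

Lemma tens_addN : left_inverse tens_zero tens_opp tens_add.
Proof.
by move=> x; rewrite -{2}[x]tens_scale1 -tens_scaleDl addNr tens_scale0.
Qed.

HB.instance Definition _ :=
  GRing.isZmodule.Build tensor tens_addA tens_addC tens_add0 tens_addN.

Lemma tens_addrE (x y : tensor) : x + y = tens_add x y. Proof. by []. Qed.

Lemma tens_scaleA c d (x : tensor) :
  tens_scale c (tens_scale d x) = tens_scale (c * d) x.
Proof.
elim/formal_sum_ind: x => s; rewrite !tens_scaleE; congr (formal_sum _).
by rewrite /tens_scale_seq -map_comp; apply: eq_map => -[v w] /=; rewrite scalerA.
Qed.

Lemma tens_scaleDr : right_distributive tens_scale +%R.
Proof.
move=> c; elim/formal_sum_ind=> s; elim/formal_sum_ind=> t.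
by rewrite !tens_addrE tens_addE !tens_scaleE tens_addE /tens_scale_seq map_cat.
Qed.

HB.instance Definition _ := GRing.Zmodule_isLmodule.Build k tensor
  tens_scaleA tens_scale1 tens_scaleDr (fun x c d => tens_scaleDl x c d).

Lemma tens_scalerE c (x : tensor) : c *: x = tens_scale c x. Proof. by []. Qed.

Definition tens (v : V) (w : W) : tensor := formal_sum [:: (v, w)].

Lemma tens_linearl w : linear (tens ^~ w).
Proof.
move=> c v v'; rewrite /tens tens_addrE tens_scalerE tens_scaleE tens_addE.
by apply: formal_sum_eq; exact: TensDl.
Qed.

Lemma tens_linearr v : linear (tens v).
Proof.
move=> c w w'; rewrite /tens tens_addrE tens_scalerE tens_scaleE tens_addE /=.
apply: formal_sum_eq; apply: TensTrans (TensDr _ _ _) _.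
rewrite -cat1s -[X in tens_eq _ X]cat1s.
by apply: TensCat; [apply: TensSym; exact: TensZ | exact: TensRefl].
Qed.

Lemma tens0l w : tens 0 w = 0.
Proof. exact: formal_sum_eq (Tens0 _ w). Qed.

Lemma formal_sumE s : formal_sum s = \sum_(p <- s) tens p.1 p.2.
Proof.
elim: s => [|[v w] s IHs]; first by rewrite big_nil.
by rewrite big_cons -IHs /tens tens_addrE tens_addE.
Qed.

Lemma tens_sumE (x : tensor) : x = \sum_(p <- summands x) tens p.1 p.2.
Proof. by rewrite -formal_sumE summandsK. Qed.

(* For bilinear f this is the linear map induced by f, i.e. f v w summed over any
   way of writing t as a sum of tens v w ([tsum_linear], [tsum_tens]); for other f
   the value depends on the representative and is meaningless. *)
Definition tsum (U : zmodType) (f : V -> W -> U) (t : tensor) : U :=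
  \sum_(p <- summands t) f p.1 p.2.

Lemma eq_tsum (U : zmodType) (f g : V -> W -> U) :
  (forall v w, f v w = g v w) -> forall t : tensor, tsum f t = tsum g t.
Proof. by move=> fg t; apply: eq_bigr => p _; exact: fg. Qed.

Section Universal.
Variables (U : lmodType k) (f : V -> W -> U).
Hypothesis linl : forall w, linear (f ^~ w).
Hypothesis linr : forall v, linear (f v).

Let fDl v v' w : f (v + v') w = f v w + f v' w.
Proof. by have := linl w 1 v v'; rewrite !scale1r. Qed.

Let fDr v w w' : f v (w + w') = f v w + f v w'.
Proof. by have := linr v 1 w w'; rewrite !scale1r. Qed.

Let f0l w : f 0 w = 0.
Proof. by apply: (@addrI _ (f 0 w)); rewrite -fDl !addr0. Qed.

Let f0r v : f v 0 = 0.
Proof. by apply: (@addrI _ (f v 0)); rewrite -fDr !addr0. Qed.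

Let fZl c v w : f (c *: v) w = c *: f v w.
Proof. by have := linl w c v 0; rewrite !addr0 f0l addr0. Qed.

Let fZr c v w : f v (c *: w) = c *: f v w.
Proof. by have := linr v c w 0; rewrite !addr0 f0r addr0. Qed.

Lemma tens_eq_sum s t : tens_eq s t ->
  \sum_(p <- s) f p.1 p.2 = \sum_(p <- t) f p.1 p.2.
Proof.
elim=> {s t} //.
- by move=> s t u _ -> _ ->.
- by move=> s s' t t' _ ss' _ tt'; rewrite !big_cat /= ss' tt'.
- by move=> s t; rewrite !big_cat /= addrC.
- by move=> v v' w; rewrite !big_cons !big_nil !addr0 /= fDl.
- by move=> v w w'; rewrite !big_cons !big_nil !addr0 /= fDr.
- by move=> c v w; rewrite !big_seq1 /= fZl fZr.
- by move=> w; rewrite big_seq1 big_nil /= f0l.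
Qed.

Lemma tsum_formal s : tsum f (formal_sum s) = \sum_(p <- s) f p.1 p.2.
Proof. exact: tens_eq_sum (summands_formal_sum s). Qed.

Lemma tsum_tens v w : tsum f (tens v w) = f v w.
Proof. by rewrite tsum_formal big_seq1. Qed.

Lemma tsum_linear : linear (tsum f).
Proof.
move=> c; elim/formal_sum_ind=> s; elim/formal_sum_ind=> t.
rewrite tens_addrE tens_scalerE tens_scaleE tens_addE !tsum_formal big_cat /=.
congr (_ + _); rewrite /tens_scale_seq big_map scaler_sumr.
by apply: eq_bigr => p _; rewrite fZl.
Qed.

End Universal.
End Tensor.

Notation "V ⊗ W" := (tensor V W) (at level 45, right associativity) : type_scope.
Notation "v ⊗ₜ w" := (tens v w) (at level 45, right associativity) : ring_scope.
Notation "\tsum_ ( x , y <- t ) F" := (tsum (fun x y => F) t)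
  (at level 41, x name, y name, F at level 41,
   format "'[' \tsum_ ( x ,  y  <-  t ) '/  '  F ']'") : ring_scope.

Record coalgebra (k : fieldType) := Coalgebra {
  coalg_space :> lmodType k;
  Delta : {linear coalg_space -> (coalg_space ⊗ coalg_space)%type};
  eps : {scalar coalg_space};
  Delta_coassoc : forall c,
    \tsum_(c1, c2 <- Delta c) \tsum_(c11, c12 <- Delta c1) (c11 ⊗ₜ c12 ⊗ₜ c2) =
    \tsum_(c1, c2 <- Delta c) (c1 ⊗ₜ Delta c2);
  Delta_counitl : forall c, \tsum_(c1, c2 <- Delta c) (eps c1 *: c2) = c;
  Delta_counitr : forall c, \tsum_(c1, c2 <- Delta c) (eps c2 *: c1) = c
}.

Arguments Delta {k _}.
Arguments eps {k _}.

(* Sweedler sums: the value is f h_1 ... h_n for multilinear f. *)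
Section Sweedler.
Variables (k : fieldType) (C : coalgebra k) (U : zmodType).

Definition sweedler2 (f : C -> C -> U) (c : C) : U := tsum f (Delta c).

Definition sweedler3 (f : C -> C -> C -> U) : C -> U :=
  sweedler2 (fun c1 => sweedler2 (f c1)).

Definition sweedler5 (f : C -> C -> C -> C -> C -> U) : C -> U :=
  sweedler3 (fun c1 c2 => sweedler3 (f c1 c2)).

End Sweedler.

Notation "\sw_ ( x , y <- h ) F" := (sweedler2 (fun x y => F) h)
  (at level 41, x name, y name, F at level 41,
   format "'[' \sw_ ( x ,  y  <-  h ) '/  '  F ']'") : ring_scope.
Notation "\sw_ ( x , y , z <- h ) F" := (sweedler3 (fun x y z => F) h)
  (at level 41, x name, y name, z name, F at level 41,
   format "'[' \sw_ ( x ,  y ,  z  <-  h ) '/  '  F ']'") : ring_scope.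
Notation "\sw_ ( x , y , z , t , u <- h ) F" :=
  (sweedler5 (fun x y z t u => F) h)
  (at level 41, x name, y name, z name, t name, u name, F at level 41,
   format "'[' \sw_ ( x ,  y ,  z ,  t ,  u  <-  h ) '/  '  F ']'") : ring_scope.

Reserved Notation "h ∙ g" (at level 40, left associativity).

(* [hone] stands for the unit map u, with u c = c *: hone, so that
   [Delta_one] and [eps_one] say that u is a coalgebra morphism; [omegaV] is the
   convolution inverse of [omega], hence uniquely determined. *)
Record coquasiBialgebra (k : fieldType) := CoquasiBialgebra {
  cqb_coalg :> coalgebra k;
  hmul : {linear (cqb_coalg ⊗ cqb_coalg)%type -> cqb_coalg}
    where "h ∙ g" := (hmul (h ⊗ₜ g));
  hone : cqb_coalg;
  omega : {scalar (cqb_coalg ⊗ cqb_coalg ⊗ cqb_coalg)%type};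
  omegaV : {scalar (cqb_coalg ⊗ cqb_coalg ⊗ cqb_coalg)%type};
  Delta_mul : forall h g : cqb_coalg,
    Delta (h ∙ g) = \sw_(h1, h2 <- h) \sw_(g1, g2 <- g) (h1 ∙ g1 ⊗ₜ h2 ∙ g2);
  eps_mul : forall h g : cqb_coalg, eps (h ∙ g) = eps h * eps g;
  Delta_one : Delta hone = hone ⊗ₜ hone;
  eps_one : eps hone = 1;
  omega_invr : forall h g l : cqb_coalg,
    \sw_(h1, h2 <- h) \sw_(g1, g2 <- g) \sw_(l1, l2 <- l)
      (omega (h1 ⊗ₜ g1 ⊗ₜ l1) * omegaV (h2 ⊗ₜ g2 ⊗ₜ l2)) =
    eps h * eps g * eps l;
  omega_invl : forall h g l : cqb_coalg,
    \sw_(h1, h2 <- h) \sw_(g1, g2 <- g) \sw_(l1, l2 <- l)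
      (omegaV (h1 ⊗ₜ g1 ⊗ₜ l1) * omega (h2 ⊗ₜ g2 ⊗ₜ l2)) =
    eps h * eps g * eps l;
  hmul_quasiassoc : forall h g l : cqb_coalg,
    \sw_(h1, h2 <- h) \sw_(g1, g2 <- g) \sw_(l1, l2 <- l)
      (omega (h2 ⊗ₜ g2 ⊗ₜ l2) *: (h1 ∙ (g1 ∙ l1))) =
    \sw_(h1, h2 <- h) \sw_(g1, g2 <- g) \sw_(l1, l2 <- l)
      (omega (h1 ⊗ₜ g1 ⊗ₜ l1) *: ((h2 ∙ g2) ∙ l2));
  hmul1h : forall h : cqb_coalg, hone ∙ h = h;
  hmulh1 : forall h : cqb_coalg, h ∙ hone = h;
  omega_cocycle : forall h g l m : cqb_coalg,
    \sw_(h1, h2 <- h) \sw_(g1, g2 <- g) \sw_(l1, l2 <- l) \sw_(m1, m2 <- m)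
      (omega (h1 ⊗ₜ g1 ⊗ₜ l1 ∙ m1) * omega (h2 ∙ g2 ⊗ₜ l2 ⊗ₜ m2)) =
    \sw_(h1, h2 <- h) \sw_(g1, g2, g3 <- g) \sw_(l1, l2, l3 <- l) \sw_(m1, m2 <- m)
      (omega (g1 ⊗ₜ l1 ⊗ₜ m1) * omega (h1 ⊗ₜ g2 ∙ l2 ⊗ₜ m2)
       * omega (h2 ⊗ₜ g3 ⊗ₜ l3));
  omega_unit : forall h g : cqb_coalg, omega (h ⊗ₜ hone ⊗ₜ g) = eps h * eps g
}.

Arguments hmul {k _}.
Notation "h ∙ g" := (hmul (h ⊗ₜ g)) : ring_scope.
Arguments hone {k}.
Arguments omega {k}.
Arguments omegaV {k}.

Record coquasiHopf (k : fieldType) := CoquasiHopf {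
  cqh_bialg :> coquasiBialgebra k;
  antipode : {linear cqh_bialg -> cqh_bialg};
  alpha : {scalar cqh_bialg};
  beta : {scalar cqh_bialg};
  Delta_antipode : forall h : cqh_bialg,
    Delta (antipode h) = \sw_(h1, h2 <- h) (antipode h2 ⊗ₜ antipode h1);
  eps_antipode : forall h : cqh_bialg, eps (antipode h) = eps h;
  antipode_alpha : forall h : cqh_bialg,
    \sw_(h1, h2, h3 <- h) (alpha h2 *: (antipode h1 ∙ h3)) = alpha h *: hone cqh_bialg;
  antipode_beta : forall h : cqh_bialg,
    \sw_(h1, h2, h3 <- h) (beta h2 *: (h1 ∙ antipode h3)) = beta h *: hone cqh_bialg;
  antipode_omega : forall h : cqh_bialg,
    \sw_(h1, h2, h3, h4, h5 <- h)
      (omega cqh_bialg (h1 ⊗ₜ antipode h3 ⊗ₜ h5) * beta h2 * alpha h4) = eps h;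
  antipode_omegaV : forall h : cqh_bialg,
    \sw_(h1, h2, h3, h4, h5 <- h)
      (omegaV cqh_bialg (antipode h1 ⊗ₜ h3 ⊗ₜ antipode h5) * alpha h2 * beta h4)
    = eps h;
  alpha_one : alpha (hone cqh_bialg) = 1;
  beta_one : beta (hone cqh_bialg) = 1
}.

Reserved Notation "a ∗ b" (at level 40, left associativity).

Record comodAlgebra (k : fieldType) (H : coquasiBialgebra k) := ComodAlgebra {
  ca_space :> lmodType k;
  rho : {linear ca_space -> (ca_space ⊗ H)%type};
  amul : {linear (ca_space ⊗ ca_space)%type -> ca_space}
    where "a ∗ b" := (amul (a ⊗ₜ b));
  aone : ca_space;
  rho_coassoc : forall a,
    \tsum_(a0, a1 <- rho a) \tsum_(a00, a01 <- rho a0) (a00 ⊗ₜ a01 ⊗ₜ a1) =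
    \tsum_(a0, a1 <- rho a) (a0 ⊗ₜ Delta a1);
  rho_counit : forall a, \tsum_(a0, a1 <- rho a) (eps a1 *: a0) = a;
  rho_mul : forall a b,
    rho (a ∗ b) =
    \tsum_(a0, a1 <- rho a) \tsum_(b0, b1 <- rho b) (a0 ∗ b0 ⊗ₜ a1 ∙ b1);
  rho_one : rho aone = aone ⊗ₜ hone H;
  amul1a : forall a, aone ∗ a = a;
  amula1 : forall a, a ∗ aone = a;
  amul_quasiassoc : forall a b c,
    (a ∗ b) ∗ c =
    \tsum_(a0, a1 <- rho a) \tsum_(b0, b1 <- rho b) \tsum_(c0, c1 <- rho c)
      (omega H (a1 ⊗ₜ b1 ⊗ₜ c1) *: (a0 ∗ (b0 ∗ c0)))
}.

Arguments rho {k H _}.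
Arguments amul {k H _}.
Notation "a ∗ b" := (amul (a ⊗ₜ b)) : ring_scope.
Arguments aone {k H}.

Section Coinvariants.
Variables (k : fieldType) (H : coquasiBialgebra k) (A : comodAlgebra H).

Definition coinvariant : pred A := fun a => rho a == a ⊗ₜ hone H.

Lemma coinvariant_submod : submod_closed coinvariant.
Proof.
split=> [|c a b]; rewrite !unfold_in.
  by rewrite linear0 tens0l.
by move=> /eqP ra /eqP rb; rewrite linearP ra rb tens_linearl.
Qed.

HB.instance Definition _ := GRing.isSubmodClosed.Build k A coinvariant
  coinvariant_submod.

Record coinv := Coinv { cval :> A; cvalP : coinvariant cval }.

HB.instance Definition _ := [isSub for cval].
HB.instance Definition _ := [Choice of coinv by <:].
HB.instance Definition _ := [SubChoice_isSubLmodule of coinv by <:].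

Lemma rho_coinv (r : coinv) : rho (cval r) = cval r ⊗ₜ hone H.
Proof. exact/eqP/cvalP. Qed.

Lemma coinvariant_one : coinvariant (aone A).
Proof. by apply/eqP; rewrite rho_one. Qed.

Lemma coinvariant_mul (r s : coinv) : coinvariant (cval r ∗ cval s).
Proof.
apply/eqP; rewrite rho_mul !rho_coinv.
under eq_tsum => a0 a1.
  rewrite tsum_tens; first by over.
  - by move=> w c x y; rewrite tens_linearr linearP tens_linearl.
  - by move=> v c x y; rewrite tens_linearr linearP tens_linearr.
rewrite /= tsum_tens ?hmul1h //.
- by move=> w c x y; rewrite tens_linearl linearP tens_linearl.
- by move=> v c x y; rewrite tens_linearl linearP tens_linearr.
Qed.

Definition coinv_one : coinv := Coinv coinvariant_one.
Definition coinv_mul (r s : coinv) : coinv := Coinv (coinvariant_mul r s).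

Lemma coinv_mulA : associative coinv_mul.
Proof.
have omega1 : omega H (hone H ⊗ₜ hone H ⊗ₜ hone H) = 1.
  by rewrite omega_unit eps_one mulr1.
have scal (c d : k) (x y : A) : d *: (c *: x + y) = c *: (d *: x) + d *: y.
  by rewrite scalerDr !scalerA mulrC.
have scal' (c d e : k) (x : A) : (c * d + e) *: x = c *: (d *: x) + e *: x.
  by rewrite scalerDl scalerA.
move=> r s t; apply: val_inj; rewrite /= amul_quasiassoc !rho_coinv.
under eq_tsum => a0 a1.
  under eq_tsum => b0 b1.
    rewrite tsum_tens; first by over.
    - by move=> w c x y; rewrite tens_linearr linearP tens_linearr linearP scal.
    - by move=> v c x y; rewrite !tens_linearr linearP scal'.
  rewrite tsum_tens; first by over.
  - by move=> w c x y; rewrite tens_linearl linearP tens_linearr linearP scal.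
  - by move=> v c x y; rewrite tens_linearl tens_linearr linearP scal'.
rewrite /= tsum_tens ?omega1 ?scale1r //.
- by move=> w c x y; rewrite tens_linearl linearP scal.
- by move=> v c x y; rewrite tens_linearl linearP scal'.
Qed.

Lemma coinv_mul1 : left_id coinv_one coinv_mul.
Proof. by move=> r; apply: val_inj; exact: amul1a. Qed.

Lemma coinv_mulr1 : right_id coinv_one coinv_mul.
Proof. by move=> r; apply: val_inj; exact: amula1. Qed.

Lemma coinv_mulDl : left_distributive coinv_mul +%R.
Proof.
move=> r s t; apply: val_inj; rewrite /= -[val r]scale1r.
by rewrite tens_linearl linearP !scale1r.
Qed.

Lemma coinv_mulDr : right_distributive coinv_mul +%R.
Proof.
move=> r s t; apply: val_inj; rewrite /= -[val s]scale1r.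
by rewrite tens_linearr linearP !scale1r.
Qed.

HB.instance Definition _ := GRing.Zmodule_isPzRing.Build coinv
  coinv_mulA coinv_mul1 coinv_mulr1 coinv_mulDl coinv_mulDr.

Lemma cval1 : cval (1 : coinv) = aone A. Proof. by []. Qed.

Lemma cvalM (r s : coinv) : cval (r * s) = cval r ∗ cval s. Proof. by []. Qed.

End Coinvariants.

Arguments coinv {k H} A.

Definition cleft (k : fieldType) (H : coquasiHopf k) (A : comodAlgebra H) : Prop :=
  exists (gamma delta : {linear H -> A}),
    [/\ forall h : H, rho (gamma h) = \sw_(h1, h2 <- h) (gamma h1 ⊗ₜ h2),
        forall h : H, rho (delta h) = \sw_(h1, h2 <- h) (delta h2 ⊗ₜ antipode H h1),
        forall h : H, \sw_(h1, h2 <- h) (delta h1 ∗ gamma h2) = alpha H h *: aone A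
      & forall h : H, \sw_(h1, h2, h3 <- h) (beta H h2 *: (gamma h1 ∗ delta h3))
                      = eps h *: aone A].

Section CrossedProduct.
Variables (k : fieldType) (H : coquasiBialgebra k) (A : comodAlgebra H).
Local Notation B := (coinv A).
Variables (act : {linear (H ⊗ B)%type -> B}) (sigma : {linear (H ⊗ H)%type -> B}).

Local Notation "h ▷ r" := (act (h ⊗ₜ r)) (at level 40).

Record crossed_system : Prop := CrossedSystem {
  act_mul : forall (h : H) (r s : B),
    h ▷ (r * s) = \sw_(h1, h2 <- h) ((h1 ▷ r) * (h2 ▷ s));
  act_one : forall h : H, h ▷ (1 : B) = eps h *: (1 : B);
  one_act : forall r : B, hone H ▷ r = r;
  act_twisted : forall (h g : H) (r : B),
    \sw_(h1, h2 <- h) \sw_(g1, g2 <- g) ((h1 ▷ (g1 ▷ r)) * sigma (h2 ⊗ₜ g2)) =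
    \sw_(h1, h2 <- h) \sw_(g1, g2 <- g) (sigma (h1 ⊗ₜ g1) * ((h2 ∙ g2) ▷ r));
  sigma_oner : forall h : H, sigma (h ⊗ₜ hone H) = eps h *: (1 : B);
  sigma_onel : forall h : H, sigma (hone H ⊗ₜ h) = eps h *: (1 : B);
  sigma_cocycle : forall h g l : H,
    \sw_(h1, h2 <- h) \sw_(g1, g2 <- g) \sw_(l1, l2 <- l)
      ((h1 ▷ sigma (g1 ⊗ₜ l1)) * sigma (h2 ⊗ₜ g2 ∙ l2)) =
    \sw_(h1, h2, h3 <- h) \sw_(g1, g2, g3 <- g) \sw_(l1, l2 <- l)
      (omegaV H (h3 ⊗ₜ g3 ⊗ₜ l2) *: (sigma (h1 ⊗ₜ g1) * sigma (h2 ∙ g2 ⊗ₜ l1)))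
}.

Definition conv_invertible : Prop :=
  exists tau : {linear (H ⊗ H)%type -> B},
    (forall h g : H,
       \sw_(h1, h2 <- h) \sw_(g1, g2 <- g) (sigma (h1 ⊗ₜ g1) * tau (h2 ⊗ₜ g2))
       = (eps h * eps g) *: (1 : B)) /\
    (forall h g : H,
       \sw_(h1, h2 <- h) \sw_(g1, g2 <- g) (tau (h1 ⊗ₜ g1) * sigma (h2 ⊗ₜ g2))
       = (eps h * eps g) *: (1 : B)).

Definition crossed_mul (x y : (B ⊗ H)%type) : (B ⊗ H)%type :=
  \tsum_(r, h <- x) \tsum_(s, g <- y)
    \sw_(h1, h2, h3 <- h) \sw_(g1, g2 <- g)
      ((r : B) * (h1 ▷ s) * sigma (h2 ⊗ₜ g1) ⊗ₜ h3 ∙ g2).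

Definition crossed_one : (B ⊗ H)%type := (1 : B) ⊗ₜ hone H.

Definition crossed_rho (x : (B ⊗ H)%type) : ((B ⊗ H) ⊗ H)%type :=
  \tsum_(r, h <- x) \sw_(h1, h2 <- h) ((r ⊗ₜ h1) ⊗ₜ h2).

Definition crossed_scale (b : B) (x : (B ⊗ H)%type) : (B ⊗ H)%type :=
  \tsum_(r, h <- x) (b * (r : B) ⊗ₜ h).

(* B ⊗ H with these operations is the crossed product determined by [act] and
   [sigma]; [crossed_rho] is I_B (x) Delta with values in (B ⊗ H) ⊗ H.
   [Phi] is an isomorphism of left B-modules and right H-comodule algebras
   from A to the crossed product. *)
Definition crossed_iso (Phi : {linear A -> (B ⊗ H)%type}) : Prop :=
  [/\ bijective Phi,
      forall (b : B) (a : A), Phi (cval b ∗ a) = crossed_scale b (Phi a),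
      forall a : A, \tsum_(a0, a1 <- rho a) (Phi a0 ⊗ₜ a1) = crossed_rho (Phi a),
      forall a b : A, Phi (a ∗ b) = crossed_mul (Phi a) (Phi b)
    & Phi (aone A) = crossed_one].

End CrossedProduct.

(* Main.v *)
From HB Require Import structures.
Require Import Defs.
From mathcomp Require Import all_boot all_algebra ring.

(** The extension B <= A is cleft exactly when A looks like B (x) H, with the
    colinear map gamma : H -> A playing the role of h |-> 1 # h.  The bridge
    between the two descriptions is the notion of a normal basis: a colinear
    gamma with gamma(1) = 1 together with a linear E : A -> B such that
    E(b gamma(h)) = eps(h) b and E(a_0) gamma(a_1) = a.  It says that
    b (x) h |-> b gamma(h) is bijective, with inverse a |-> E(a_0) (x) a_1.

    From a normal basis to a crossed product.  Put h.b = E(gamma(h) b) and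
    sigma(h,g) = E(gamma(h) gamma(g)); then gamma(h) b = (h_1.b) gamma(h_2) and
    gamma(h) gamma(g) = sigma(h_1,g_1) gamma(h_2 g_2).  Coinvariants associate
    with everything, because omega is trivial as soon as one argument is 1, so
    products of elements b gamma(h) can be rewritten in this normal form.  Each
    axiom of a crossed system is the comparison, under E, of the two normal
    forms of one (quasi-)associativity relation of A
    ([normal_basis_crossed_system], [normal_basis_crossed_iso]).

    From a cleft extension to a normal basis.  After dividing gamma by the
    invertible coinvariant gamma(1), take E(a) = a_0 beta(a_1) delta(a_2).
    This is coinvariant by the antipode axiom for beta, and
    E(a_0) gamma(a_1) = a is the antipode axiom relating omega, alpha and beta
    ([rho_coinv_part], [coinv_part_gamma]).

    Invertibility of sigma.  The classical inverse is built from
    gamma(hg) gamma(g)^-1; here one needs the corrected quotient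
      T(h,g) = omega^-1(h_2, g_2, S(g_4)) beta(g_3) gamma(h_1 g_1) delta(g_5)
    and tau(h,g) = E(T(h,g)).  Undoing the parentheses in
    gamma(h) (gamma(g_1) beta(g_2) delta(g_3)) = eps(g) gamma(h) gives
    sigma * tau = 1.  For the other side T(-,g) is colinear, hence
    T(h,g) = tau(h_1,g) gamma(h_2), and T(h,g_1) gamma(g_2) = gamma(hg);
    the latter rests on a scalar identity for omega, alpha, beta
    ([pentagon_antipode]), a consequence of the 3-cocycle equation.

    From a crossed product to a cleft extension.  Let gamma(h) correspond to
    1 # h and put delta(h) = tau(S(h_2), h_4) alpha(h_3) gamma(S(h_1)), tau
    being the inverse of sigma.  Then delta * gamma = alpha is a direct
    computation.  The remaining identity follows formally: the elements
    e(h) = gamma(h_1) beta(h_2) delta(h_3) are coinvariant and satisfy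
    e(h_1) gamma(h_2) = gamma(h) by the same arguments as for E above, so the
    uniqueness of coordinates in B # H forces e(h) = eps(h) 1.

    All these verifications are computations with Sweedler sums; the tactic
    [sweedler] settles the steps which only use coassociativity, counitality
    and multilinearity, so that a proof displays just the regroupings between
    which an axiom is applied. *)

Set Implicit Arguments.
Unset Strict Implicit.
Unset Printing Implicit Defensive.

Import GRing.Theory.
Local Open Scope ring_scope.

(** * Sums over tensors of multilinear expressions *)

Section TsumLinear.
Variable k : fieldType.
Implicit Types U V W X Y Z : lmodType k.

(** Unbundled linearity, so that it can be established for any lambda
    expression by inspection of its body. *)
Definition lin V U (f : V -> U) : Prop := linear f.
Definition bilin V W U (f : V -> W -> U) : Prop :=
  (forall w, lin (f^~ w)) /\ (forall v, lin (f v)).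
Definition trilin V W X U (f : V -> W -> X -> U) : Prop :=
  [/\ forall w x, lin (fun v => f v w x), forall v x, lin (fun w => f v w x)
    & forall v w, lin (f v w)].

Lemma exists_linear V U (f : V -> U) : lin f ->
  exists g : {linear V -> U}, forall v, g v = f v.
Proof.
move=> lf; pose L := GRing.isLinear.Build k V U *:%R f lf.
by pose g : {linear V -> U} := HB.pack f L; exists g.
Qed.

Lemma lin0 V U (f : V -> U) : lin f -> f 0 = 0.
Proof.
move=> lf; apply: (@addrI _ (f 0)).
by have := lf 1 0 0; rewrite !scale1r !addr0 => {1}<-.
Qed.

Lemma linD V U (f : V -> U) x y : lin f -> f (x + y) = f x + f y.
Proof. by move=> lf; have := lf 1 x y; rewrite !scale1r. Qed.

Lemma linZ V U (f : V -> U) c x : lin f -> f (c *: x) = c *: f x.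
Proof. by move=> lf; have := lf c x 0; rewrite !addr0 lin0 // addr0. Qed.

Lemma lin_id V : lin (fun x : V => x). Proof. by []. Qed.

Lemma lin_comp V W U (f : {linear W -> U}) (g : V -> W) :
  lin g -> lin (fun x => f (g x)).
Proof. by move=> lg c x y; rewrite lg linearP. Qed.

Lemma lin_scalar V W (f : {scalar W}) (g : V -> W) :
  lin g -> lin (fun x => f (g x) : k^o).
Proof. by move=> lg c x y; rewrite lg linearP. Qed.

Lemma lin_compf V W U (f : W -> U) (g : V -> W) :
  lin f -> lin g -> lin (fun x => f (g x)).
Proof. by move=> lf lg c x y; rewrite lg lf. Qed.

Lemma lin_tensl V W X (f : V -> W) (x : X) : lin f -> lin (fun v => f v ⊗ₜ x).
Proof. by move=> lf c u v; rewrite lf tens_linearl. Qed.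

Lemma lin_tensr V W X (f : V -> W) (x : X) : lin f -> lin (fun v => x ⊗ₜ f v).
Proof. by move=> lf c u v; rewrite lf tens_linearr. Qed.

Lemma lin_scalel V U (f : V -> k^o) (u : U) : lin f -> lin (fun v => f v *: u).
Proof. by move=> lf c x y; rewrite lf scalerDl scalerA. Qed.

Lemma lin_scaler V U (c : k) (f : V -> U) : lin f -> lin (fun v => c *: f v).
Proof. by move=> lf d x y; rewrite lf scalerDr !scalerA mulrC. Qed.

Lemma lin_mull V (f : V -> k^o) (d : k) : lin f -> lin (fun v => f v * d : k^o).
Proof. by move=> lf c x y; rewrite lf mulrDl scalerAl. Qed.

Lemma lin_mulr V (f : V -> k^o) (d : k) : lin f -> lin (fun v => d * f v : k^o).
Proof. by move=> lf c x y; rewrite lf mulrDr scalerAr. Qed.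

Lemma lin_tsum V X Y U (F : V -> X -> Y -> U) (t : (X ⊗ Y)%type) :
  (forall x y, lin (fun v => F v x y)) -> lin (fun v => tsum (F v) t).
Proof.
move=> lF c u v; rewrite /tsum scaler_sumr -big_split /=.
by apply: eq_bigr => p _; rewrite lF.
Qed.

Lemma lin_tsum_arg V X Y U (F : X -> Y -> U) (t : V -> (X ⊗ Y)%type) :
  bilin F -> lin t -> lin (fun v => tsum F (t v)).
Proof. by move=> [l r] lt c u v; rewrite lt tsum_linear. Qed.

Lemma bilinP V W U (f : V -> W -> U) :
  (forall w, lin (fun v => f v w)) -> (forall v, lin (f v)) -> bilin f.
Proof. by []. Qed.

Lemma tensZl V W c (v : V) (w : W) : (c *: v) ⊗ₜ w = c *: (v ⊗ₜ w).
Proof. by rewrite (linZ _ _ (lin_tensl _ (@lin_id _))). Qed.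

Lemma tensZr V W c (v : V) (w : W) : v ⊗ₜ (c *: w) = c *: (v ⊗ₜ w).
Proof. by rewrite (linZ _ _ (lin_tensr _ (@lin_id _))). Qed.

Lemma linear_scale V W (f : {linear V -> W}) c v : f (c *: v) = c *: f v.
Proof. exact: linearZ. Qed.

Lemma scalar_scale V (f : {scalar V}) c v : f (c *: v) = c * f v.
Proof. exact: linearZ. Qed.

(** Equalities of scalars are proved after multiplication by a vector, since
    the reordering lemmas below concern sums of vectors. *)
Lemma scal_ext (c d : k) : (forall U (u : U), c *: u = d *: u) -> c = d.
Proof. by move=> /(_ k^o 1); rewrite /GRing.scale /= !mulr1. Qed.

Lemma tsum_scalel V W U (F : V -> W -> k) (t : (V ⊗ W)%type) (u : U) :
  tsum F t *: u = tsum (fun v w => F v w *: u) t.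
Proof. by rewrite /tsum scaler_suml. Qed.

Lemma lin_tsumE V U X Y (f : V -> U) (F : X -> Y -> V) (t : (X ⊗ Y)%type) :
  lin f -> f (tsum F t) = tsum (fun x y => f (F x y)) t.
Proof.
move=> lf; rewrite /tsum; elim: (summands t) => [|p s IHs].
  by rewrite !big_nil lin0.
by rewrite !big_cons linD // IHs.
Qed.

Lemma tsum_tensE X Y U (F : X -> Y -> U) (x : X) (y : Y) : bilin F ->
  tsum F (x ⊗ₜ y) = F x y.
Proof. by case=> l r; rewrite tsum_tens. Qed.

Lemma tsum_exch X Y V W U (F : X -> Y -> U) (t : (X ⊗ Y)%type)
    (s : (V ⊗ W)%type) (G : X -> Y -> V -> W -> U) :
  (forall x y, F x y = tsum (G x y) s) ->
  tsum F t = tsum (fun v w => tsum (fun x y => G x y v w) t) s.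
Proof. by move=> E; rewrite (eq_tsum E) /tsum exchange_big. Qed.

Lemma tensor_ext V W U (f g : (V ⊗ W)%type -> U) : lin f -> lin g ->
  (forall v w, f (v ⊗ₜ w) = g (v ⊗ₜ w)) -> f =1 g.
Proof.
move=> lf lg fg x; rewrite (tens_sumE x); elim: (summands x) => [|p s IHs].
  by rewrite !big_nil !lin0.
by rewrite !big_cons !linD // fg IHs.
Qed.

(** Common form of coassociativity for coalgebras (V = W) and for comodules:
    a letter split from the left factor may be split from the right factor
    instead, inside an arbitrary trilinear expression G. *)
Lemma tsum_reassoc V W U (D : V -> (V ⊗ W)%type) (D' : W -> (W ⊗ W)%type)
    (t : (V ⊗ W)%type) (F : V -> W -> U) (G : V -> W -> W -> U) :
  \tsum_(x, y <- t) \tsum_(p, q <- D x) (p ⊗ₜ q ⊗ₜ y) =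
    \tsum_(x, y <- t) (x ⊗ₜ D' y) ->
  (forall x y, F x y = tsum (fun p q => G p q y) (D x)) -> trilin G ->
  tsum F t = tsum (fun p z => tsum (fun q y => G p q y) (D' z)) t.
Proof.
move=> Dt FE [G1 G2 G3]; rewrite (eq_tsum FE).
pose f (s : (V ⊗ W ⊗ W)%type) := tsum (fun p => tsum (fun q y => G p q y)) s.
have bG p : bilin (fun q y => G p q y) by split=> *; [exact: G2 | exact: G3].
have bf : bilin (fun p (s : (W ⊗ W)%type) => tsum (fun q y => G p q y) s).
  split=> [s | p]; first by apply: lin_tsum => *; exact: G1.
  exact: (lin_tsum_arg (bG p) (@lin_id _)).
have lf : lin f by exact: (lin_tsum_arg bf (@lin_id _)).
have := congr1 f Dt; rewrite (lin_tsumE _ _ lf).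
under eq_tsum => x y.
  rewrite (lin_tsumE _ _ lf).
  under eq_tsum => p q do rewrite /f (tsum_tensE _ _ bf) (tsum_tensE _ _ (bG _)).
  over.
rewrite /= => ->; rewrite (lin_tsumE _ _ lf).
by apply: eq_tsum => p z; rewrite /f tsum_tensE.
Qed.

(** Common form of the counit axioms.  The counit value may sit anywhere in the
    summand: it occurs as the last argument of G', and the summand is linear
    in it. *)
Lemma tsum_absorb V W X U (e : V -> W -> k^o) (pr : V -> W -> X)
    (t : (V ⊗ W)%type) (c : X) (F : V -> W -> U)
    (G' : V -> W -> k^o -> U) (G : k^o -> X -> U) :
  tsum (fun x y => e x y *: pr x y) t = c ->
  (forall x y, F x y = G' x y (e x y)) ->
  (forall x y a, G' x y a = G a (pr x y)) ->
  bilin G -> tsum F t = G 1 c.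
Proof.
move=> <- FE GE [G1 G2]; rewrite (lin_tsumE _ _ (G2 1)).
apply: eq_tsum => x y; rewrite FE GE linZ //.
by rewrite -[in LHS](mulr1 (e x y)); exact: (linZ (e x y) (1 : k^o) (G1 _)).
Qed.

Section Coalgebra.
Variable C : coalgebra k.
Implicit Types c x y : C.

Lemma tsum_coassoc U (F : C -> C -> U) (G : C -> C -> C -> U) c :
  (forall x y, F x y = tsum (fun p q => G p q y) (Delta x)) -> trilin G ->
  tsum F (Delta c) = tsum (fun p z => tsum (fun q y => G p q y) (Delta z)) (Delta c).
Proof. exact: tsum_reassoc (Delta_coassoc c). Qed.

Lemma tsum_counitl U (F : C -> C -> U) (G' : C -> C -> k^o -> U)
    (G : k^o -> C -> U) c :
  (forall x y, F x y = G' x y (eps x)) -> (forall x y a, G' x y a = G a y) ->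
  bilin G -> tsum F (Delta c) = G 1 c.
Proof.
exact: (tsum_absorb (e := fun x _ => eps x) (pr := fun _ y => y) (Delta_counitl c)).
Qed.

Lemma tsum_counitr U (F : C -> C -> U) (G' : C -> C -> k^o -> U)
    (G : k^o -> C -> U) c :
  (forall x y, F x y = G' x y (eps y)) -> (forall x y a, G' x y a = G a x) ->
  bilin G -> tsum F (Delta c) = G 1 c.
Proof.
exact: (tsum_absorb (e := fun _ y => eps y) (pr := fun x _ => x) (Delta_counitr c)).
Qed.
End Coalgebra.

Section Comodule.
Variables (H : coquasiBialgebra k) (A : comodAlgebra H).
Local Notation B := (coinv A).

Lemma tsum_rho_coassoc U (F : A -> H -> U) (G : A -> H -> H -> U) (a : A) :
  (forall x y, F x y = tsum (fun p q => G p q y) (rho x)) -> trilin G ->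
  tsum F (rho a) = tsum (fun p z => tsum (fun q y => G p q y) (Delta z)) (rho a).
Proof. exact: tsum_reassoc (rho_coassoc a). Qed.

Lemma tsum_rho_counit U (F : A -> H -> U) (G' : A -> H -> k^o -> U)
    (G : k^o -> A -> U) (a : A) :
  (forall x y, F x y = G' x y (eps y)) -> (forall x y b, G' x y b = G b x) ->
  bilin G -> tsum F (rho a) = G 1 a.
Proof.
exact: (tsum_absorb (e := fun _ y => eps y) (pr := fun x _ => x) (rho_counit a)).
Qed.

Lemma cvalZ c (b : B) : cval (c *: b) = c *: cval b.
Proof. by []. Qed.

Lemma coinvZl c (r s : B) : (c *: r) * s = c *: (r * s).
Proof.
apply: val_inj; change (cval (c *: r) ∗ cval s = c *: (cval r ∗ cval s)).
exact: (linZ _ _ (lin_comp amul (lin_tensl _ (@lin_id _)))).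
Qed.

Lemma coinvZr c (r s : B) : r * (c *: s) = c *: (r * s).
Proof.
apply: val_inj; change (cval r ∗ cval (c *: s) = c *: (cval r ∗ cval s)).
exact: (linZ _ _ (lin_comp amul (lin_tensr _ (@lin_id _)))).
Qed.

Lemma lin_coinvl V (f : V -> B) (s : B) : lin f -> lin (fun v => f v * s).
Proof. by move=> lf c u v; rewrite lf mulrDl coinvZl. Qed.

Lemma lin_coinvr V (f : V -> B) (s : B) : lin f -> lin (fun v => s * f v).
Proof. by move=> lf c u v; rewrite lf mulrDr coinvZr. Qed.

Lemma lin_cval V (f : V -> B) : lin f -> lin (fun v => cval (f v)).
Proof. by move=> lf c u v; rewrite lf. Qed.
End Comodule.

End TsumLinear.

Lemma appl_eq (T U : Type) (f g : T -> U) (a : T) : f = g -> f a = g a.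
Proof. by move->. Qed.

(** * A tactic for Sweedler calculus *)

(** Proves linearity of [fun x => e] by recursion on e.  The branches for
    applied variables use hypotheses [lin f] and [bilin f]. *)
Ltac lin :=
  cbv beta;
  lazymatch goal with
  | |- forall _, _ => intro; lin
  | |- bilin _ => apply: bilinP; lin
  | |- trilin _ => split; lin
  | |- lin (fun x => x) => exact: lin_id
  | |- lin (fun x => @?b x) =>
    first
    [ assumption
    (* Here a pattern variable that should avoid x may match a term containing
       x; then refine fails and the match goes on to the next branch. *)
    | match goal with
      | |- @lin ?k ?V ?U (fun x => @tsum _ ?X ?Y _ (fun y z => @?F x y z) ?t) =>
          refine (@lin_tsum k V X Y U F t _)
      | |- @lin ?k ?V ?U (fun x => @tsum _ ?X ?Y _ ?F (@?t x)) =>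
          refine (@lin_tsum_arg k V X Y U F t _ _)
      | |- lin (fun x => (@?f x) ⊗ₜ ?u) => refine (@lin_tensl _ _ _ _ f u _)
      | |- lin (fun x => ?u ⊗ₜ (@?f x)) => refine (@lin_tensr _ _ _ _ f u _)
      | |- @lin ?k ?V ?U (fun x => ?c *: (@?f x)) =>
          refine (@lin_scaler k V U c f _)
      | |- lin (fun x => (@?f x) *: ?u) => refine (@lin_scalel _ _ _ f u _)
      | |- lin (fun x => (@?f x) * ?u) =>
          first [refine (@lin_mull _ _ f u _) | refine (@lin_coinvl _ _ _ _ f u _)]
      | |- lin (fun x => ?u * (@?f x)) =>
          first [refine (@lin_mulr _ _ f u _) | refine (@lin_coinvr _ _ _ _ f u _)]
      | |- lin (fun x => cval (@?f x)) => refine (@lin_cval _ _ _ _ f _)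
      | |- lin (fun x => @GRing.Linear.sort _ _ _ _ ?f (@?g x)) =>
          first [refine (@lin_comp _ _ _ _ f g _) | refine (@lin_scalar _ _ _ f g _)]
      | e : bilin ?X |- lin (fun x => ?X (@?g x) ?u) =>
          refine (@lin_compf _ _ _ _ (fun z => X z u) g (proj1 e u) _)
      | e : bilin ?X |- lin (fun x => ?X ?u (@?g x)) =>
          refine (@lin_compf _ _ _ _ (X u) g (proj2 e u) _)
      | e : lin ?f |- lin (fun x => ?f (@?g x)) =>
          refine (@lin_compf _ _ _ _ f g e _)
      end ]; lin
  | |- @lin ?k ?V ?U ?f => change (@lin k V U (fun x => f x)); lin
  end.

Ltac pull_scale :=
  first
  [ progress rewrite ?(tensZl, tensZr, cvalZ, coinvZl, coinvZr)
  | match goal with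
    | |- context [@GRing.Linear.sort _ _ _ _ ?f (@GRing.scale _ _ ?c ?v)] =>
      first [ rewrite (@linear_scale _ _ _ f c v)
            | rewrite (@scalar_scale _ _ f c v)]
    end ].

Ltac sw_unfold := rewrite ?/sweedler5 ?/sweedler3 ?/sweedler2.

(* A let on h is a sum over Delta h or rho h. *)
Ltac is_let t h :=
  lazymatch t with
  | @GRing.Linear.sort _ _ _ _ (@Delta _ _) h => idtac
  | @GRing.Linear.sort _ _ _ _ (@rho _ _ _) h => idtac
  end.

Ltac has_let E h :=
  match E with
  | context [@GRing.Linear.sort _ _ _ _ (@Delta _ _) h] => idtac
  | context [@GRing.Linear.sort _ _ _ _ (@rho _ _ _) h] => idtac
  end.

Ltac get_let E :=
  match E with
  | context [@GRing.Linear.sort _ _ _ _ (@Delta _ _) ?h] =>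
      let _ := match goal with _ => is_var h end in h
  | context [@GRing.Linear.sort _ _ _ _ (@rho _ _ _) ?h] =>
      let _ := match goal with _ => is_var h end in h
  | _ => constr:(tt)
  end.

Ltac get_tsum E h :=
  match E with
  | context [@tsum ?k ?V ?W ?U ?F ?t] =>
    let _ := match goal with
     | _ => is_let t h
     | _ => tryif has_let t h then fail else has_let F h end in
    constr:(@tsum k V W U F t)
  | _ => constr:(tt)
  end.

(** On a goal [E = ?R], moves the let on h to the front of E: through linear
    contexts by [lin_tsumE], past other sums by [tsum_exch]. *)
Ltac pull h :=
  cbv beta;
  lazymatch goal with
  | |- ?E = _ =>
    lazymatch E with
    | @tsum ?k ?V ?W _ ?F ?t =>
      tryif is_let t h then reflexivity
      else tryif has_let t h then pull_ctx h
      else (refine (@tsum_exch k V W _ _ _ F t _ _ _); intros ? ?; pull h)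
    | _ => pull_ctx h
    end
  end
with pull_ctx h :=
  lazymatch goal with
  | |- ?E = _ =>
    let t := get_tsum E h in
    lazymatch t with
    | @tsum ?k ?V ?W ?U ?F ?t =>
        lazymatch eval pattern (@tsum k V W U F t) in E with
        | ?f _ =>
          refine (eq_trans (@lin_tsumE k _ _ V W f F t _) _); [lin | pull h]
        end
    | _ => fail
    end
  end.

Ltac sw_coaction :=
  match goal with
  | e : (forall x, @GRing.Linear.sort _ _ _ _ (@rho _ _ _) (_ x) = _) |- _ =>
      rewrite !e
  end.

(** Rewrite rules for units, extended below as they are established. *)
Ltac sw_units := fail.

Ltac sw_rules ex :=
  repeat (first
  [ progress rewrite ?Delta_mul ?Delta_antipode ?Delta_one ?rho_mul ?rho_one
      ?rho_coinv ?omega_unit ?eps_antipode ?eps_mul ?eps_one ?hmul1h ?hmulh1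
  | sw_coaction
  | sw_units
  | ex
  | pull_scale
  | match goal with
    | |- context [@tsum ?k ?V ?W ?U ?F (?x ⊗ₜ ?y)] =>
      rewrite (@tsum_tensE k V W _ F x y); [cbv beta | by lin]
    end]; sw_unfold; cbv beta).

(* The right-hand side is an evar in most goals met below; it must not be seen
   by rewriting. *)
Ltac hide_rhs tac :=
  lazymatch goal with
  | |- _ = ?r => let R := fresh "R" in set (R := r); tac; unfold R; clear R
  end.

(** On a goal [E = ?R], brings E into the form of nested lets on variables
    followed by a summand without lets. *)
Ltac expand ex :=
  cbv beta; hide_rhs ltac:(sw_rules ex);
  lazymatch goal with
  | |- ?E = _ =>
    let h := get_let E in
    lazymatch h with
    | tt => reflexivity
    | _ =>
        refine (eq_trans _ _); [pull h |];
        cbv beta;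
        refine (@eq_tsum _ _ _ _ _ _ _ _); intros ? ?; expand ex
    end
  end.

(** Coassociativity at the head let, repeated until its left letter is not
    split any more. *)
Ltac coassoc_head :=
  cbv beta;
  lazymatch goal with
  | |- tsum ?F ?t = _ =>
   first [
    (first
      [ refine (eq_trans (@tsum_coassoc _ _ _ F _ _ _ _) _)
      | refine (eq_trans (@tsum_rho_coassoc _ _ _ _ F _ _ _ _) _) ]);
    [ let x := fresh "x" in let y := fresh "y" in
      intros x y; cbv beta;
      lazymatch goal with |- ?E = _ => has_let E x end;
      pull x
    | lin
    | coassoc_head ]
   | reflexivity ]
  end.

(* Exhibits the left-hand side as a function applied to eps x. *)
Ltac at_eps x :=
  lazymatch goal with
  | |- ?E = _ =>
    match E with
    | context [@GRing.Linear.sort ?a ?b ?c ?d (@eps ?k ?C) x] =>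
      lazymatch eval pattern (@GRing.Linear.sort a b c d (@eps k C) x) in E with
      | ?f _ => refine (@appl_eq _ _ f _ _ _); reflexivity
      end
    end
  end.

Ltac counit_head :=
  cbv beta;
  lazymatch goal with
  | |- tsum ?F ?t = _ =>
   first [
     refine (eq_trans (@tsum_counitl _ _ _ F _ _ _ _ _ _) _);
     [ let x := fresh "x" in let y := fresh "y" in
       intros x y; cbv beta; at_eps x
     | intros ? ? ?; reflexivity | lin | cbv beta; reflexivity]
   | refine (eq_trans (@tsum_counitr _ _ _ F _ _ _ _ _ _) _);
     [ let x := fresh "x" in let y := fresh "y" in
       intros x y; cbv beta; at_eps y
     | intros ? ? ?; reflexivity | lin | cbv beta; reflexivity]
   | refine (eq_trans (@tsum_rho_counit _ _ _ _ F _ _ _ _ _ _) _);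
     [ let x := fresh "x" in let y := fresh "y" in
       intros x y; cbv beta; at_eps y
     | intros ? ? ?; reflexivity | lin | cbv beta; reflexivity]
   | reflexivity ]
  end.

(** Normal form: every iterated coproduct is nested to the right and no letter
    occurs under eps.  It is unique up to the order of lets on unrelated
    letters. *)
Ltac canon :=
  cbv beta;
  lazymatch goal with
  | |- tsum _ _ = _ =>
    refine (eq_trans _ _); [coassoc_head |];
    refine (eq_trans _ _);
    [refine (@eq_tsum _ _ _ _ _ _ _ _); intros ? ?; canon |];
    counit_head
  | |- _ => reflexivity
  end.

Ltac sw_head E :=
  lazymatch E with
  | tsum _ (@GRing.Linear.sort _ _ _ _ _ ?v) => v
  | _ => constr:(tt)
  end.

(** Compares two normal forms, bringing the lets of the right-hand side in the
    order of those of the left-hand side. *)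
Ltac sw_match leaf :=
  cbv beta;
  lazymatch goal with
  | |- ?L = ?R =>
    let v := sw_head L in
    lazymatch v with
    | tt => leaf
    | _ =>
        symmetry; refine (eq_trans _ _); [pull v | ];
        symmetry; cbv beta;
        refine (@eq_tsum _ _ _ _ _ _ _ _); intros ? ?; sw_match leaf
    end
  end.

Ltac sw_normal ex := sw_unfold;
  refine (eq_trans _ _); [expand ex |];
  refine (eq_trans _ _); [canon |].

Ltac sw_scal := repeat pull_scale; rewrite ?(scale1r, mul1r, mulr1, scalerA) /=.
Ltac sw_leaf :=
  first [reflexivity | sw_scal; first [reflexivity | congr (_ *: _); ring]].

(** Equality of two Sweedler sums by the rules of calculus: coassociativity,
    counit, multilinearity, exchange of sums, and the coproducts and coactions
    of products.  [sweedler using t] applies the rewriting tactic t during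
    normalization; [sweedler_by t] closes the final equality of summands,
    without sums, by t. *)
Ltac sweedler_by_using leaf ex :=
  sw_normal ex; symmetry; sw_normal ex; symmetry; sw_match leaf.
Tactic Notation "sweedler_by" tactic(t) :=
  sweedler_by_using ltac:(t) ltac:(fail).
Tactic Notation "sweedler" "using" tactic(t) :=
  sweedler_by_using ltac:(sw_leaf) ltac:(t).
Tactic Notation "sweedler" := sweedler_by_using ltac:(sw_leaf) ltac:(fail).

(** [inside t] rewrites with t the summand of the left-hand side, under all
    leading lets; [inside_lets n t] does so under the first n of them. *)
Tactic Notation "inside_lets" integer(n) tactic(t) :=
  refine (eq_trans _ _);
    [ do n (refine (@eq_tsum _ _ _ _ _ _ _ _); intros ? ?; cbv beta);
      hide_rhs t; reflexivity
    | cbv beta].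
Tactic Notation "inside" tactic(t) :=
  refine (eq_trans _ _);
    [ repeat (refine (@eq_tsum _ _ _ _ _ _ _ _); intros ? ?; cbv beta);
      hide_rhs t; reflexivity
    | cbv beta].

(* Multiplies by a vector inside n nested sums of scalars. *)
Tactic Notation "scale_sums" integer(n) :=
  sw_unfold; do n (rewrite tsum_scalel; apply: eq_tsum => ? ?); reflexivity.

(** * Consequences of the axioms of the reassociator *)

Section Reassociator.
Variables (k : fieldType) (H : coquasiBialgebra k).

Lemma omega_invr_v (U : lmodType k) (u : U) (h g l : H) :
  \sw_(h1, h2 <- h) \sw_(g1, g2 <- g) \sw_(l1, l2 <- l)
    ((omega H (h1 ⊗ₜ g1 ⊗ₜ l1) * omegaV H (h2 ⊗ₜ g2 ⊗ₜ l2)) *: u)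
  = (eps h * eps g * eps l) *: u.
Proof. by rewrite -omega_invr; symmetry; scale_sums 3. Qed.

Lemma omega_invl_v (U : lmodType k) (u : U) (h g l : H) :
  \sw_(h1, h2 <- h) \sw_(g1, g2 <- g) \sw_(l1, l2 <- l)
    ((omegaV H (h1 ⊗ₜ g1 ⊗ₜ l1) * omega H (h2 ⊗ₜ g2 ⊗ₜ l2)) *: u)
  = (eps h * eps g * eps l) *: u.
Proof. by rewrite -omega_invl; symmetry; scale_sums 3. Qed.

Lemma omega_cocycle_v (U : lmodType k) (u : U) (h g l m : H) :
  \sw_(h1, h2 <- h) \sw_(g1, g2 <- g) \sw_(l1, l2 <- l) \sw_(m1, m2 <- m)
    ((omega H (h1 ⊗ₜ g1 ⊗ₜ l1 ∙ m1) * omega H (h2 ∙ g2 ⊗ₜ l2 ⊗ₜ m2)) *: u) =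
  \sw_(h1, h2 <- h) \sw_(g1, g2, g3 <- g) \sw_(l1, l2, l3 <- l) \sw_(m1, m2 <- m)
    ((omega H (g1 ⊗ₜ l1 ⊗ₜ m1) * omega H (h1 ⊗ₜ g2 ∙ l2 ⊗ₜ m2)
      * omega H (h2 ⊗ₜ g3 ⊗ₜ l3)) *: u).
Proof.
have E := congr1 (fun c => c *: u) (omega_cocycle h g l m).
by refine (eq_trans _ (eq_trans E _)); [symmetry; scale_sums 4 | scale_sums 6].
Qed.

(** An idempotent of a convolution algebra with a right inverse is the unit. *)
Lemma conv_idem_unit (X Y : H -> H -> k^o) : bilin X -> bilin Y ->
  (forall (U : lmodType k) (u : U) x y,
    \sw_(x1, x2 <- x) \sw_(y1, y2 <- y) ((X x1 y1 * X x2 y2) *: u) = X x y *: u) ->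
  (forall (U : lmodType k) (u : U) x y,
    \sw_(x1, x2 <- x) \sw_(y1, y2 <- y) ((X x1 y1 * Y x2 y2) *: u)
    = (eps x * eps y) *: u) ->
  forall x y, X x y = eps x * eps y.
Proof.
move=> bX bY XX XY g l; apply: scal_ext => U w; rewrite -XY; symmetry.
transitivity (\sw_(x, x3 <- g) \sw_(y, y3 <- l) (X x y *: (Y x3 y3 *: w))).
  by inside (rewrite -scalerA).
inside (rewrite -XX).
transitivity (\sw_(x, x3 <- g) \sw_(y, y3 <- l) (X x y *:
    \sw_(x1, x2 <- x3) \sw_(y1, y2 <- y3) ((X x1 y1 * Y x2 y2) *: w))).
  by sweedler.
inside (rewrite XY).
by sweedler.
Qed.

(** The cocycle equation with 1 in the first two places says that omega(1,-,-)
    is idempotent; the last two places give omega(-,-,1). *)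
Lemma omega_1l (g l : H) : omega H (hone H ⊗ₜ g ⊗ₜ l) = eps g * eps l.
Proof.
apply: (conv_idem_unit (X := fun x y => omega H (hone H ⊗ₜ x ⊗ₜ y))
  (Y := fun x y => omegaV H (hone H ⊗ₜ x ⊗ₜ y))); first lin; first lin.
- move=> U u x y; symmetry.
  transitivity (\sw_(l1, l2 <- x) \sw_(m1, m2 <- y)
      (eps l1 *: (eps m1 *: (omega H (hone H ⊗ₜ l2 ⊗ₜ m2) *: u)))).
    by sweedler.
  have E := omega_cocycle_v u (hone H) (hone H) x y.
  by refine (eq_trans _ (eq_trans E _)); sweedler.
- move=> U u x y.
  by have := omega_invr_v u (hone H) x y; rewrite eps_one mul1r => <-; sweedler.
Qed.

Lemma omega_r1 (g l : H) : omega H (g ⊗ₜ l ⊗ₜ hone H) = eps g * eps l.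
Proof.
apply: (conv_idem_unit (X := fun x y => omega H (x ⊗ₜ y ⊗ₜ hone H))
  (Y := fun x y => omegaV H (x ⊗ₜ y ⊗ₜ hone H))); first lin; first lin.
- move=> U u x y; symmetry.
  transitivity (\sw_(l1, l2 <- x) \sw_(m1, m2 <- y)
      (eps l2 *: (eps m2 *: (omega H (l1 ⊗ₜ m1 ⊗ₜ hone H) *: u)))).
    by sweedler.
  have E := omega_cocycle_v u x y (hone H) (hone H).
  by refine (eq_trans _ (eq_trans E _)); sweedler.
- move=> U u x y.
  by have := omega_invr_v u x y (hone H); rewrite eps_one mulr1 => <-; sweedler.
Qed.

Ltac sw_units ::= progress rewrite ?omega_1l ?omega_r1.

Lemma omegaV_r1 (g l : H) : omegaV H (g ⊗ₜ l ⊗ₜ hone H) = eps g * eps l.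
Proof.
apply: scal_ext => U u.
have := omega_invl_v u g l (hone H); rewrite eps_one mulr1 => <-.
by symmetry; sweedler.
Qed.

Ltac sw_units ::= progress rewrite ?omega_1l ?omega_r1 ?omegaV_r1.

(** The cocycle equation solved for omega(hg,l,m) omega^-1(h,g,l), the form in
    which it moves a bracketing past an antipode. *)
Lemma omega_cocycle_solved (U : lmodType k) (u : U) (h g l m : H) :
  \sw_(h1, h2 <- h) \sw_(g1, g2 <- g) \sw_(l1, l2 <- l)
    ((omega H (h1 ∙ g1 ⊗ₜ l1 ⊗ₜ m) * omegaV H (h2 ⊗ₜ g2 ⊗ₜ l2)) *: u) =
  \sw_(h1, h2 <- h) \sw_(g1, g2, g3 <- g) \sw_(l1, l2, l3 <- l) \sw_(m1, m2, m3 <- m)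
    ((omegaV H (h1 ⊗ₜ g1 ⊗ₜ l1 ∙ m1) * omega H (g2 ⊗ₜ l2 ⊗ₜ m2) *
      omega H (h2 ⊗ₜ g3 ∙ l3 ⊗ₜ m3)) *: u).
Proof.
transitivity
  (\sw_(ha, h3 <- h) \sw_(ga, g3 <- g) \sw_(la, l3 <- l) \sw_(ma, m3 <- m)
   \sw_(h1, h2 <- h3) \sw_(g1, g2 <- g3) \sw_(l1, l2 <- l3)
    ((eps ha * eps ga * eps (la ∙ ma)) *:
     ((omega H (h1 ∙ g1 ⊗ₜ l1 ⊗ₜ m3) * omegaV H (h2 ⊗ₜ g2 ⊗ₜ l2)) *: u))).
  by sweedler.
inside (rewrite -omega_invl_v).
transitivity
  (\sw_(ha, h3 <- h) \sw_(ga, g3 <- g) \sw_(la, l3 <- l) \sw_(ma, m3 <- m)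
   \sw_(hb, h4 <- h3) \sw_(gb, g4 <- g3) \sw_(lb, l4 <- l3)
    (omegaV H (ha ⊗ₜ ga ⊗ₜ la ∙ ma) *:
    \sw_(h1, h2 <- hb) \sw_(g1, g2 <- gb) \sw_(l1, l2 <- lb) \sw_(m1, m2 <- m3)
      ((omega H (h1 ⊗ₜ g1 ⊗ₜ l1 ∙ m1) * omega H (h2 ∙ g2 ⊗ₜ l2 ⊗ₜ m2)) *:
        (omegaV H (h4 ⊗ₜ g4 ⊗ₜ l4) *: u)))).
  by sweedler.
inside (rewrite omega_cocycle_v).
transitivity
  (\sw_(ha, h3 <- h) \sw_(ga, gb, g3 <- g) \sw_(la, lb, l3 <- l)
   \sw_(ma, mb, m3 <- m) \sw_(hb, h4 <- h3) \sw_(gc, g4 <- g3) \sw_(lc, l4 <- l3)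
    ((omegaV H (ha ⊗ₜ ga ⊗ₜ la ∙ ma) * omega H (gb ⊗ₜ lb ⊗ₜ mb)
      * omega H (hb ⊗ₜ gc ∙ lc ⊗ₜ m3)) *:
    \sw_(h1, h2 <- h4) \sw_(g1, g2 <- g4) \sw_(l1, l2 <- l4)
      ((omega H (h1 ⊗ₜ g1 ⊗ₜ l1) * omegaV H (h2 ⊗ₜ g2 ⊗ₜ l2)) *: u))).
  by sweedler.
inside (rewrite omega_invr_v).
by sweedler.
Qed.

Lemma hmul_quasiassocV (h g l : H) :
  \sw_(h1, h2 <- h) \sw_(g1, g2 <- g) \sw_(l1, l2 <- l)
    (omegaV H (h2 ⊗ₜ g2 ⊗ₜ l2) *: ((h1 ∙ g1) ∙ l1)) =
  \sw_(h1, h2 <- h) \sw_(g1, g2 <- g) \sw_(l1, l2 <- l)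
    (omegaV H (h1 ⊗ₜ g1 ⊗ₜ l1) *: (h2 ∙ (g2 ∙ l2))).
Proof.
transitivity (\sw_(h1, h2 <- h) \sw_(g1, g2 <- g) \sw_(l1, l2 <- l)
   \sw_(a, b <- h2) \sw_(c, d <- g2) \sw_(e, f <- l2)
      ((eps h1 * eps g1 * eps l1) *: (omegaV H (b ⊗ₜ d ⊗ₜ f) *: ((a ∙ c) ∙ e)))).
  by sweedler.
inside (rewrite -omega_invl_v).
transitivity (\sw_(h1, h2 <- h) \sw_(g1, g2 <- g) \sw_(l1, l2 <- l)
   \sw_(h3, h4 <- h2) \sw_(g3, g4 <- g2) \sw_(l3, l4 <- l2)
     ((omegaV H (h1 ⊗ₜ g1 ⊗ₜ l1) * omegaV H (h4 ⊗ₜ g4 ⊗ₜ l4)) *: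
   \sw_(h1, h2 <- h3) \sw_(g1, g2 <- g3) \sw_(l1, l2 <- l3)
      (omega H (h1 ⊗ₜ g1 ⊗ₜ l1) *: ((h2 ∙ g2) ∙ l2)))).
  by sweedler.
inside (rewrite -hmul_quasiassoc).
transitivity (\sw_(h1, h2 <- h) \sw_(g1, g2 <- g) \sw_(l1, l2 <- l)
   \sw_(h3, h4 <- h2) \sw_(g3, g4 <- g2) \sw_(l3, l4 <- l2)
     (omegaV H (h1 ⊗ₜ g1 ⊗ₜ l1) *:
   \sw_(a, b <- h4) \sw_(c, d <- g4) \sw_(e, f <- l4)
      ((omega H (a ⊗ₜ c ⊗ₜ e) * omegaV H (b ⊗ₜ d ⊗ₜ f)) *: (h3 ∙ (g3 ∙ l3))))).
  by sweedler.
inside (rewrite omega_invr_v).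
by sweedler.
Qed.

End Reassociator.

(* Redefinitions made inside a section do not outlive it. *)
Ltac sw_units ::= progress rewrite ?omega_1l ?omega_r1 ?omegaV_r1.

Section Antipode.
Variables (k : fieldType) (H : coquasiHopf k).
Local Notation S := (antipode H).

Lemma antipode_one : S (hone H) = hone H.
Proof.
have := antipode_alpha (hone H); rewrite alpha_one scale1r => E.
by rewrite -[RHS]E; symmetry; sweedler_by (by rewrite alpha_one scale1r).
Qed.

Lemma antipode_omega_v (U : lmodType k) (u : U) (h : H) :
  \sw_(h1, h2, h3, h4, h5 <- h)
    ((omega H (h1 ⊗ₜ S h3 ⊗ₜ h5) * beta H h2 * alpha H h4) *: u) = eps h *: u.
Proof. by rewrite -antipode_omega; symmetry; scale_sums 4. Qed.

(** By [omega_cocycle_solved] the product of omega and omega^-1 becomes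
      omega^-1(h_1, g_1, S(g_7) g_9) omega(g_2, S(g_6), g_10)
        omega(h_2, g_3 S(g_5), g_11),
    where beta(g_4) collapses g_3 S(g_5) and alpha(g_8) collapses S(g_7) g_9
    to 1; the middle factor is the antipode axiom for omega. *)
Lemma pentagon_antipode (U : lmodType k) (u : U) (h g : H) :
  \sw_(h1, h2 <- h) \sw_(g1, g2, x <- g) \sw_(g3, g4, y <- x) \sw_(g5, g6, g7 <- y)
   ((omega H (h1 ∙ g1 ⊗ₜ S g5 ⊗ₜ g7) * omegaV H (h2 ⊗ₜ g2 ⊗ₜ S g4)
     * beta H g3 * alpha H g6) *: u)
  = (eps h * eps g) *: u.
Proof.
transitivity (\sw_(g1, g2, g3, g4, g5 <- g) ((beta H g2 * alpha H g4) *: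
  \sw_(h1, h2 <- h) \sw_(x1, x2 <- g1) \sw_(l1, l2 <- S g3)
     ((omega H (h1 ∙ x1 ⊗ₜ l1 ⊗ₜ g5) * omegaV H (h2 ⊗ₜ x2 ⊗ₜ l2)) *: u))).
  by sweedler.
inside (rewrite omega_cocycle_solved).
transitivity (\sw_(h1, h2 <- h) \sw_(g1, g2, z <- g) \sw_(p, x <- z)
    \sw_(g3, q, y <- x) \sw_(g4, g5 <- y)
    ((omegaV H (h1 ⊗ₜ g1 ⊗ₜ \sw_(a, b, c <- q) (alpha H b *: (S a ∙ c))) *
      omega H (g2 ⊗ₜ S g3 ⊗ₜ g4) *
      omega H (h2 ⊗ₜ \sw_(a, b, c <- p) (beta H b *: (a ∙ S c)) ⊗ₜ g5)) *: u)).
  by sweedler.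
inside (rewrite antipode_alpha antipode_beta).
transitivity (\sw_(g1, g2, g3, g4, g5 <- g)
      ((omega H (g1 ⊗ₜ S g3 ⊗ₜ g5) * beta H g2 * alpha H g4) *: (eps h *: u))).
  by sweedler.
by rewrite antipode_omega_v scalerA mulrC.
Qed.

End Antipode.

(** * Associativity with coinvariants *)

Section ComodAlg.
Variables (k : fieldType) (H : coquasiBialgebra k) (A : comodAlgebra H).
Implicit Types (b : coinv A) (x y z : A).

Lemma amulA_coinvl b x y : (cval b ∗ x) ∗ y = cval b ∗ (x ∗ y).
Proof. by rewrite amul_quasiassoc; sweedler. Qed.
Lemma amulA_coinvm b x y : (x ∗ cval b) ∗ y = x ∗ (cval b ∗ y).
Proof. by rewrite amul_quasiassoc; sweedler. Qed.
Lemma amulA_coinvr b x y : (x ∗ y) ∗ cval b = x ∗ (y ∗ cval b).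
Proof. by rewrite amul_quasiassoc; sweedler. Qed.

Lemma amul_quasiassocV x y z :
  x ∗ (y ∗ z) = \tsum_(x0, x1 <- rho x) \tsum_(y0, y1 <- rho y) \tsum_(z0, z1 <- rho z)
      (omegaV H (x1 ⊗ₜ y1 ⊗ₜ z1) *: ((x0 ∗ y0) ∗ z0)).
Proof.
symmetry; inside (rewrite amul_quasiassoc).
transitivity (\tsum_(x0, x1 <- rho x) \tsum_(y0, y1 <- rho y) \tsum_(z0, z1 <- rho z)
  \sw_(h1, h2 <- x1) \sw_(g1, g2 <- y1) \sw_(l1, l2 <- z1)
      ((omega H (h1 ⊗ₜ g1 ⊗ₜ l1) * omegaV H (h2 ⊗ₜ g2 ⊗ₜ l2)) *: (x0 ∗ (y0 ∗ z0)))).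
  by sweedler.
inside_lets 3 (rewrite omega_invr_v).
by sweedler.
Qed.
End ComodAlg.

(** * The crossed product of a normal basis *)

Section NormalBasis.
Variables (k : fieldType) (H : coquasiBialgebra k) (A : comodAlgebra H).
Local Notation B := (coinv A).
Variables (gamma : {linear H -> A}) (E : {linear A -> B}).
Hypothesis rho_gamma : forall h, rho (gamma h) = \sw_(h1, h2 <- h) (gamma h1 ⊗ₜ h2).
Hypothesis gamma_one : gamma (hone H) = aone A.
Hypothesis E_gamma : forall (b : B) h, E (cval b ∗ gamma h) = eps h *: b.
Hypothesis gammaE : forall a, \tsum_(a0, a1 <- rho a) (cval (E a0) ∗ gamma a1) = a.
Implicit Types (h g l : H) (r s b : B).
Variables (act : {linear (H ⊗ B)%type -> B}) (sigma : {linear (H ⊗ H)%type -> B}).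
Hypothesis actE : forall h b, act (h ⊗ₜ b) = E (gamma h ∗ cval b).
Hypothesis sigmaE : forall h g, sigma (h ⊗ₜ g) = E (gamma h ∗ gamma g).
Local Notation "h ▷ r" := (act (h ⊗ₜ r)) (at level 40).

Lemma E_gamma1 h : E (gamma h) = eps h *: (1 : B).
Proof. by rewrite -E_gamma cval1 amul1a. Qed.

Lemma E_coinv b : E (cval b) = b.
Proof. by rewrite -[cval b]amula1 -gamma_one E_gamma eps_one scale1r. Qed.

(** The action and the cocycle are the coordinates of gamma(h) b and of
    gamma(h) gamma(g); this lemma and the next one reduce any product of
    elements b gamma(h) to coordinates. *)
Lemma gamma_coinv h b : gamma h ∗ cval b = \sw_(h1, h2 <- h) (cval (h1 ▷ b) ∗ gamma h2).
Proof.
rewrite -[LHS]gammaE; sweedler_by (by rewrite actE).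
Qed.

Lemma gamma_mul h g : gamma h ∗ gamma g =
  \sw_(h1, h2 <- h) \sw_(g1, g2 <- g) (cval (sigma (h1 ⊗ₜ g1)) ∗ gamma (h2 ∙ g2)).
Proof.
rewrite -[LHS]gammaE; sweedler_by (by rewrite sigmaE).
Qed.

(** Compares the coordinates of gamma(h) (r s) = (gamma(h) r) s. *)
Lemma normal_basis_act_mul h r s : h ▷ (r * s) = \sw_(h1, h2 <- h) ((h1 ▷ r) * (h2 ▷ s)).
Proof.
transitivity (E (\sw_(h1, h2, h3 <- h) (cval ((h1 ▷ r) * (h2 ▷ s)) ∗ gamma h3))); last first.
  by sweedler using (rewrite E_gamma).
rewrite actE cvalM -amulA_coinvm gamma_coinv; congr (E _).
transitivity (\sw_(h1, h2 <- h) (cval (h1 ▷ r) ∗ (gamma h2 ∗ cval s))).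
  by sweedler_by (by rewrite amulA_coinvl).
inside (rewrite gamma_coinv).
by sweedler_by (by rewrite cvalM amulA_coinvl).
Qed.

Lemma gamma_coinv2 h g r : gamma h ∗ (gamma g ∗ cval r) =
  \sw_(h1, h2 <- h) \sw_(g1, g2 <- g) (cval (h1 ▷ (g1 ▷ r)) ∗ (gamma h2 ∗ gamma g2)).
Proof.
transitivity (\sw_(g1, g2 <- g) ((gamma h ∗ cval (g1 ▷ r)) ∗ gamma g2)).
  by rewrite gamma_coinv; sweedler_by (by rewrite amulA_coinvm).
inside (rewrite gamma_coinv).
by sweedler_by (by rewrite amulA_coinvl).
Qed.

(** Compares the coordinates of gamma(h) (gamma(g) r) = (gamma(h) gamma(g)) r. *)
Lemma normal_basis_twisted h g r :
  \sw_(h1, h2 <- h) \sw_(g1, g2 <- g) ((h1 ▷ (g1 ▷ r)) * sigma (h2 ⊗ₜ g2)) =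
  \sw_(h1, h2 <- h) \sw_(g1, g2 <- g) (sigma (h1 ⊗ₜ g1) * ((h2 ∙ g2) ▷ r)).
Proof.
transitivity (E (gamma h ∗ (gamma g ∗ cval r))).
  symmetry; rewrite gamma_coinv2.
  transitivity (E (\sw_(h1, h2, h3 <- h) \sw_(g1, g2, g3 <- g)
      (cval ((h1 ▷ (g1 ▷ r)) * sigma (h2 ⊗ₜ g2)) ∗ gamma (h3 ∙ g3)))); last first.
    by sweedler using (rewrite E_gamma).
  congr (E _); inside (rewrite gamma_mul).
  by sweedler_by (by rewrite cvalM amulA_coinvl).
rewrite -amulA_coinvr gamma_mul.
transitivity (E (\sw_(h1, h2 <- h) \sw_(g1, g2 <- g)
      (cval (sigma (h1 ⊗ₜ g1)) ∗ (gamma (h2 ∙ g2) ∗ cval r)))).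
  by sweedler_by (by rewrite amulA_coinvl).
transitivity (E (\sw_(h1, h2, h3 <- h) \sw_(g1, g2, g3 <- g)
      (cval (sigma (h1 ⊗ₜ g1) * ((h2 ∙ g2) ▷ r)) ∗ gamma (h3 ∙ g3)))); last first.
  by sweedler using (rewrite E_gamma).
congr (E _); inside (rewrite gamma_coinv).
by sweedler_by (by rewrite cvalM amulA_coinvl).
Qed.

Lemma gamma_mul_assocl h g l : (gamma h ∗ gamma g) ∗ gamma l =
  \sw_(h1, h2, h3 <- h) \sw_(g1, g2, g3 <- g) \sw_(l1, l2 <- l)
    (cval (sigma (h1 ⊗ₜ g1) * sigma (h2 ∙ g2 ⊗ₜ l1)) ∗ gamma ((h3 ∙ g3) ∙ l2)).
Proof.
rewrite gamma_mul.
transitivity (\sw_(h1, h2 <- h) \sw_(g1, g2 <- g)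
      (cval (sigma (h1 ⊗ₜ g1)) ∗ (gamma (h2 ∙ g2) ∗ gamma l))).
  by sweedler_by (by rewrite amulA_coinvl).
inside (rewrite gamma_mul).
by sweedler_by (by rewrite cvalM amulA_coinvl).
Qed.

Lemma gamma_mul_assocr h g l : gamma h ∗ (gamma g ∗ gamma l) =
  \sw_(h1, h2, h3 <- h) \sw_(g1, g2, g3 <- g) \sw_(l1, l2, l3 <- l)
    (cval ((h1 ▷ sigma (g1 ⊗ₜ l1)) * sigma (h2 ⊗ₜ g2 ∙ l2)) ∗ gamma (h3 ∙ (g3 ∙ l3))).
Proof.
rewrite gamma_mul.
transitivity (\sw_(g1, g2 <- g) \sw_(l1, l2 <- l)
      ((gamma h ∗ cval (sigma (g1 ⊗ₜ l1))) ∗ gamma (g2 ∙ l2))).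
  by sweedler_by (by rewrite amulA_coinvm).
inside (rewrite gamma_coinv).
transitivity (\sw_(h1, h2 <- h) \sw_(g1, g2 <- g) \sw_(l1, l2 <- l)
      (cval (h1 ▷ sigma (g1 ⊗ₜ l1)) ∗ (gamma h2 ∗ gamma (g2 ∙ l2)))).
  by sweedler_by (by rewrite amulA_coinvl).
inside (rewrite gamma_mul).
by sweedler_by (by rewrite cvalM amulA_coinvl).
Qed.

(** Compares the coordinates of the two bracketings of gamma(h) gamma(g) gamma(l),
    which differ by omega^-1. *)
Lemma normal_basis_cocycle h g l :
  \sw_(h1, h2 <- h) \sw_(g1, g2 <- g) \sw_(l1, l2 <- l)
      ((h1 ▷ sigma (g1 ⊗ₜ l1)) * sigma (h2 ⊗ₜ g2 ∙ l2)) =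
  \sw_(h1, h2, h3 <- h) \sw_(g1, g2, g3 <- g) \sw_(l1, l2 <- l)
      (omegaV H (h3 ⊗ₜ g3 ⊗ₜ l2) *: (sigma (h1 ⊗ₜ g1) * sigma (h2 ∙ g2 ⊗ₜ l1))).
Proof.
transitivity (E (gamma h ∗ (gamma g ∗ gamma l))).
  by symmetry; rewrite gamma_mul_assocr; sweedler using (rewrite E_gamma).
rewrite amul_quasiassocV.
transitivity (E (\sw_(h1, h2 <- h) \sw_(g1, g2 <- g) \sw_(l1, l2 <- l)
  (omegaV H (h2 ⊗ₜ g2 ⊗ₜ l2) *: ((gamma h1 ∗ gamma g1) ∗ gamma l1)))).
  by sweedler.
transitivity (E (\sw_(h1, h2 <- h) \sw_(g1, g2 <- g) \sw_(l1, l2 <- l)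
  (omegaV H (h2 ⊗ₜ g2 ⊗ₜ l2) *: \sw_(h1, a, h3 <- h1) \sw_(g1, b, g3 <- g1) \sw_(l1, c <- l1)
    (cval (sigma (h1 ⊗ₜ g1) * sigma (a ∙ b ⊗ₜ l1)) ∗ gamma ((h3 ∙ g3) ∙ c))))).
  by congr (E _); inside (rewrite gamma_mul_assocl).
by sweedler using (rewrite E_gamma).
Qed.

Lemma normal_basis_crossed_system : crossed_system act sigma.
Proof.
split.
- exact: normal_basis_act_mul.
- by move=> h; rewrite actE cval1 amula1 E_gamma1.
- by move=> r; rewrite actE gamma_one amul1a E_coinv.
- exact: normal_basis_twisted.
- by move=> h; rewrite sigmaE gamma_one amula1 E_gamma1.
- by move=> h; rewrite sigmaE gamma_one amul1a E_gamma1.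
- exact: normal_basis_cocycle.
Qed.

Lemma E_coinv_mul b a : E (cval b ∗ a) = b * E a.
Proof.
rewrite -[in LHS](gammaE a).
transitivity (\tsum_(a0, a1 <- rho a) E (cval (b * E a0) ∗ gamma a1)).
  by sweedler_by (by rewrite cvalM amulA_coinvl).
by sweedler using (rewrite E_gamma).
Qed.

Section Iso.
Variable Phi : {linear A -> (B ⊗ H)%type}.
Hypothesis PhiE : forall a, Phi a = \tsum_(a0, a1 <- rho a) (E a0 ⊗ₜ a1).

Definition unPhi (t : (B ⊗ H)%type) : A := \tsum_(r, h <- t) (cval r ∗ gamma h).

Lemma unPhi_lin : lin unPhi.
Proof. by rewrite /unPhi; lin. Qed.

Lemma unPhi_tens r h : unPhi (r ⊗ₜ h) = cval r ∗ gamma h.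
Proof. by rewrite /unPhi tsum_tensE //; lin. Qed.

Lemma PhiK : cancel Phi unPhi.
Proof.
move=> a; rewrite PhiE (lin_tsumE _ _ unPhi_lin) -[RHS]gammaE.
by inside_lets 1 (rewrite unPhi_tens).
Qed.

Lemma unPhiK : cancel unPhi Phi.
Proof.
apply: tensor_ext => [||r h].
- by apply: lin_comp unPhi_lin.
- exact: lin_id.
- by rewrite unPhi_tens PhiE; sweedler using (rewrite E_gamma).
Qed.

(** The formula for the crossed multiplication is what
    (r gamma(h)) (s gamma(g)) = r ((gamma(h) s) gamma(g)) becomes in coordinates. *)
Lemma unPhi_crossed_mul x y : unPhi (crossed_mul act sigma x y) = unPhi x ∗ unPhi y.
Proof.
have lM t : lin (fun x => crossed_mul act sigma x t) by rewrite /crossed_mul; sw_unfold; lin.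
have lM' t : lin (crossed_mul act sigma t) by rewrite /crossed_mul; sw_unfold; lin.
have lP := unPhi_lin.
move: x; apply: tensor_ext; [exact: lin_compf|apply: lin_comp; lin|move=> r h].
move: y; apply: tensor_ext; [exact: lin_compf|apply: lin_comp; lin|move=> s g].
rewrite !unPhi_tens /crossed_mul tsum_tensE; last by sw_unfold; lin.
rewrite tsum_tensE; last by sw_unfold; lin.
rewrite amulA_coinvl -(amulA_coinvm s (gamma h)) gamma_coinv.
transitivity (\sw_(h1, h2 <- h) (cval (r * (h1 ▷ s)) ∗ (gamma h2 ∗ gamma g))); last first.
  by sweedler_by (by rewrite cvalM !amulA_coinvl).
symmetry; inside (rewrite gamma_mul).
rewrite /unPhi.
by sweedler_by (by rewrite !cvalM !amulA_coinvl).
Qed.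

Lemma normal_basis_crossed_iso : crossed_iso act sigma Phi.
Proof.
split.
- by exists unPhi; [exact: PhiK | exact: unPhiK].
- move=> b a; rewrite !PhiE /crossed_scale.
  by sweedler_by (by rewrite E_coinv_mul).
- by move=> a; rewrite PhiE /crossed_rho; sweedler using (rewrite PhiE).
- by move=> a b; rewrite -{1}(PhiK a) -{1}(PhiK b) -unPhi_crossed_mul unPhiK.
- by rewrite PhiE rho_one tsum_tensE; [rewrite -cval1 E_coinv | lin].
Qed.
End Iso.

End NormalBasis.

(** * The normal basis of a cleft extension *)

Section CoinvariantPart.
Variables (k : fieldType) (H : coquasiHopf k) (A : comodAlgebra H).
Local Notation B := (coinv A).
Local Notation S := (antipode H).
Variables (gamma delta : {linear H -> A}).
Hypothesis rho_gamma : forall h : H, rho (gamma h) = \sw_(h1, h2 <- h) (gamma h1 ⊗ₜ h2).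
Hypothesis rho_delta : forall h : H, rho (delta h) = \sw_(h1, h2 <- h) (delta h2 ⊗ₜ S h1).
Hypothesis delta_gamma : forall h : H,
  \sw_(h1, h2 <- h) (delta h1 ∗ gamma h2) = alpha H h *: aone A.

Definition coinv_part (a : A) : A :=
  \tsum_(a0, a1 <- rho a) \sw_(x, y <- a1) (beta H x *: (a0 ∗ delta y)).

(** The coaction of a_0 beta(a_1) delta(a_2) has a_1 beta(a_2) S(a_3) in its
    right factor, which the antipode axiom replaces by beta(a_1) 1. *)
Lemma rho_coinv_part a : rho (coinv_part a) = coinv_part a ⊗ₜ hone H.
Proof.
transitivity (\tsum_(a0, x <- rho a) \sw_(p, y <- x)
  ((a0 ∗ delta y) ⊗ₜ \sw_(a, b, c <- p) (beta H b *: (a ∙ S c)))).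
  by rewrite /coinv_part; sweedler.
inside_lets 2 (rewrite antipode_beta).
by rewrite /coinv_part; sweedler.
Qed.

(** Reassociating (a_0 delta(a_2)) gamma(a_3) brings delta next to gamma, where
    they contract to alpha, at the price of the factor omega(a_1, S(a_3), a_5)
    required by the antipode axiom.  The converse direction relies on this lemma
    to prove the identity for gamma * delta. *)
Lemma coinv_part_gamma a : \tsum_(a0, a1 <- rho a) (coinv_part a0 ∗ gamma a1) = a.
Proof.
transitivity (\tsum_(a0, x <- rho a) \sw_(b, c, d <- x) (beta H b *: ((a0 ∗ delta c) ∗ gamma d))).
  by rewrite /coinv_part; sweedler.
inside (rewrite amul_quasiassoc).
transitivity (\tsum_(a0, x <- rho a) \sw_(x1,x2,x3,x4,x5 <- x)
  ((omega H (x1 ⊗ₜ S x3 ⊗ₜ x5) * beta H x2) *: (a0 ∗ \sw_(c, d <- x4) (delta c ∗ gamma d)))).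
  by sweedler.
inside (rewrite delta_gamma).
transitivity (\tsum_(a0, x <- rho a) \sw_(x1,x2,x3,x4,x5 <- x)
  ((omega H (x1 ⊗ₜ S x3 ⊗ₜ x5) * beta H x2 * alpha H x4) *: a0)).
  by sweedler_by (sw_scal; rewrite amula1; congr (_ *: _); ring).
inside_lets 1 (rewrite antipode_omega_v).
by sweedler.
Qed.

Lemma coinv_part_lin : lin coinv_part.
Proof. by rewrite /coinv_part; sw_unfold; lin. Qed.

Lemma exists_coinv_part : exists E : {linear A -> B}, forall a, cval (E a) = coinv_part a.
Proof.
have cP a : coinvariant (coinv_part a) by apply/eqP; exact: rho_coinv_part.
have lE : lin (fun a => Coinv (cP a)).
  by move=> c x y; apply: val_inj; exact: coinv_part_lin.
by have [E cval_E] := exists_linear lE; exists E => a; rewrite cval_E.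
Qed.
End CoinvariantPart.

(** * Convolution inverse of the cocycle *)

Section Cleft.
Variables (k : fieldType) (H : coquasiHopf k) (A : comodAlgebra H).
Local Notation B := (coinv A).
Local Notation S := (antipode H).
Variables (gamma delta : {linear H -> A}).
Hypothesis rho_gamma : forall h : H, rho (gamma h) = \sw_(h1, h2 <- h) (gamma h1 ⊗ₜ h2).
Hypothesis rho_delta : forall h : H, rho (delta h) = \sw_(h1, h2 <- h) (delta h2 ⊗ₜ S h1).
Hypothesis delta_gamma : forall h : H,
  \sw_(h1, h2 <- h) (delta h1 ∗ gamma h2) = alpha H h *: aone A.
Hypothesis gamma_delta : forall h : H,
  \sw_(h1, h2, h3 <- h) (beta H h2 *: (gamma h1 ∗ delta h3)) = eps h *: aone A.
Variable E : {linear A -> B}.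
Hypothesis cval_E : forall a, cval (E a) = coinv_part delta a.

Lemma cleft_E_gamma (b : B) (h : H) : E (cval b ∗ gamma h) = eps h *: b.
Proof.
apply: val_inj; change (cval (E (cval b ∗ gamma h)) = eps h *: cval b); rewrite cval_E.
transitivity (cval b ∗ \sw_(h1, h2, h3 <- h) (beta H h2 *: (gamma h1 ∗ delta h3))).
  by rewrite /coinv_part; sweedler_by (by sw_scal; rewrite amulA_coinvl).
by rewrite gamma_delta; sw_scal; rewrite amula1.
Qed.

Lemma cleft_gammaE a : \tsum_(a0, a1 <- rho a) (cval (E a0) ∗ gamma a1) = a.
Proof.
rewrite -[RHS](coinv_part_gamma rho_gamma rho_delta delta_gamma).
by apply: eq_tsum => ? ?; rewrite cval_E.
Qed.

Hypothesis gamma_one : gamma (hone H) = aone A.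
Variable sigma : {linear (H ⊗ H)%type -> B}.
Hypothesis sigmaE : forall h g, sigma (h ⊗ₜ g) = E (gamma h ∗ gamma g).

Let E_mul := E_coinv_mul cleft_E_gamma cleft_gammaE.
Let gammaM := gamma_mul rho_gamma cleft_gammaE sigmaE.

(** The element gamma(hg) gamma(g)^-1, with the associativity correction: the
    factor gamma(g) can be cancelled, see [gamma_quotient_gamma]. *)
Definition gamma_quotient (h g : H) : A :=
  \sw_(h1, h2 <- h) \sw_(g1, g2, g3, g4, g5 <- g)
    ((omegaV H (h2 ⊗ₜ g2 ⊗ₜ S g4) * beta H g3) *: (gamma (h1 ∙ g1) ∗ delta g5)).

Lemma gamma_quotient_bilin : bilin gamma_quotient.
Proof. by rewrite /gamma_quotient; sw_unfold; lin. Qed.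

(** Both sides equal gamma(h) (gamma(g_1) beta(g_2) delta(g_3)); the left-hand
    one after shifting parentheses and expanding gamma(h) gamma(g). *)
Lemma sigma_gamma_quotient h g :
  \sw_(h1, h2 <- h) \sw_(g1, g2 <- g)
    (cval (sigma (h1 ⊗ₜ g1)) ∗ gamma_quotient h2 g2) = eps g *: gamma h.
Proof.
transitivity (gamma h ∗ \sw_(h1, h2, h3 <- g) (beta H h2 *: (gamma h1 ∗ delta h3))); last first.
  by rewrite gamma_delta; sw_scal; rewrite amula1.
symmetry.
transitivity (\sw_(h1, h2, h3 <- g) (beta H h2 *: (gamma h ∗ (gamma h1 ∗ delta h3)))).
  by sweedler.
inside (rewrite amul_quasiassocV).
transitivity (\sw_(h1, h2 <- h) \sw_(g1, g2, g3, g4, g5 <- g)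
    ((omegaV H (h2 ⊗ₜ g2 ⊗ₜ S g4) * beta H g3) *: ((gamma h1 ∗ gamma g1) ∗ delta g5))).
  by sweedler.
inside (rewrite gammaM).
rewrite /gamma_quotient.
by sweedler_by (by sw_scal; rewrite amulA_coinvl).
Qed.

(** The right factor of the coaction is (h_2 g_2) S(g_6) with weights
    omega^-1(h_3, g_3, S(g_5)) and beta(g_4).  Quasi-associativity in H turns it
    into h_3 (g_3 S(g_5)), whose inner product beta collapses. *)
Lemma rho_gamma_quotient h g :
  rho (gamma_quotient h g) = \sw_(h1, h2 <- h) (gamma_quotient h1 g ⊗ₜ h2).
Proof.
transitivity (\sw_(h1, hb <- h) \sw_(g1, gb, g4, q, g7 <- g)
  (beta H g4 *: ((gamma (h1 ∙ g1) ∗ delta g7) ⊗ₜ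
  \sw_(h2, h3 <- hb) \sw_(g2, g3 <- gb) \sw_(l1, l2 <- S q)
     (omegaV H (h3 ⊗ₜ g3 ⊗ₜ l2) *: ((h2 ∙ g2) ∙ l1))))).
  by rewrite /gamma_quotient; sweedler.
inside (rewrite hmul_quasiassocV).
transitivity (\sw_(h1, h2, h3 <- h) \sw_(g1, g2, p, g4, g5 <- g)
  (omegaV H (h2 ⊗ₜ g2 ⊗ₜ S g4) *: ((gamma (h1 ∙ g1) ∗ delta g5) ⊗ₜ
    h3 ∙ \sw_(a, b, c <- p) (beta H b *: (a ∙ S c))))).
  by sweedler.
inside (rewrite antipode_beta).
by rewrite /gamma_quotient; sweedler.
Qed.

(** After reassociation delta and gamma contract to alpha; what remains of
    omega, omega^-1, alpha and beta is the scalar of [pentagon_antipode]. *)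
Lemma gamma_quotient_gamma h g :
  \sw_(g1, g2 <- g) (gamma_quotient h g1 ∗ gamma g2) = gamma (h ∙ g).
Proof.
transitivity (\sw_(h1, h2 <- h) \sw_(g1, g2, g3, g4, x <- g) \sw_(g5, g6 <- x)
    ((omegaV H (h2 ⊗ₜ g2 ⊗ₜ S g4) * beta H g3) *: ((gamma (h1 ∙ g1) ∗ delta g5) ∗ gamma g6))).
  by rewrite /gamma_quotient; sweedler.
inside (rewrite amul_quasiassoc).
transitivity (\sw_(h1, h2, h3 <- h) \sw_(g1, g2, g3, g4, x <- g) \sw_(g5, g6, y <- x) \sw_(p, g7 <- y)
    ((omega H (h2 ∙ g2 ⊗ₜ S g6 ⊗ₜ g7) * omegaV H (h3 ⊗ₜ g3 ⊗ₜ S g5) * beta H g4) *: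
       (gamma (h1 ∙ g1) ∗ \sw_(a, b <- p) (delta a ∗ gamma b)))).
  by sweedler.
inside (rewrite delta_gamma).
transitivity (\sw_(ha, hb <- h) \sw_(ga, gb <- g)
  \sw_(h1,h2<-hb) \sw_(g1,g2,x<-gb) \sw_(g3,g4,y<-x) \sw_(g5,g6,g7<-y)
   ((omega H (h1 ∙ g1 ⊗ₜ S g5 ⊗ₜ g7) * omegaV H (h2 ⊗ₜ g2 ⊗ₜ S g4) * beta H g3 * alpha H g6) *:
     gamma (ha ∙ ga))).
  by sweedler_by (sw_scal; rewrite amula1; congr (_ *: _); ring).
inside_lets 2 (rewrite pentagon_antipode).
by sweedler.
Qed.

(** By colinearity, h |-> gamma_quotient(h,g) has coordinates
    tau(h_1,g) gamma(h_2), tau being its coinvariant part. *)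
Lemma cleft_sigma_invertible : conv_invertible sigma.
Proof.
have bU := gamma_quotient_bilin.
have [tau tauE] : exists tau : {linear (H ⊗ H)%type -> B},
    forall t, tau t = \tsum_(h, g <- t) E (gamma_quotient h g).
  by apply: exists_linear; lin.
have tau_tens h g : tau (h ⊗ₜ g) = E (gamma_quotient h g) by rewrite tauE tsum_tensE //; lin.
have gamma_quotientE h g : gamma_quotient h g = \sw_(h1, h2 <- h) (cval (tau (h1 ⊗ₜ g)) ∗ gamma h2).
  rewrite -[LHS]cleft_gammaE.
  by sweedler_by_using ltac:(by rewrite tau_tens) ltac:(rewrite rho_gamma_quotient).
exists tau; split=> h g.
- transitivity (E (\sw_(h1, h2 <- h) \sw_(g1, g2 <- g)
      (cval (sigma (h1 ⊗ₜ g1)) ∗ gamma_quotient h2 g2))).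
    by sweedler_by (by rewrite E_mul tau_tens).
  by rewrite sigma_gamma_quotient linear_scale -[gamma h]amul1a -cval1 cleft_E_gamma scalerA mulrC.
- transitivity (E (\sw_(g1, g2 <- g) (gamma_quotient h g1 ∗ gamma g2))); last first.
    by rewrite gamma_quotient_gamma -[gamma _]amul1a -cval1 cleft_E_gamma eps_mul.
  transitivity (E (\sw_(g1, g2 <- g)
     ((\sw_(h1, h2 <- h) (cval (tau (h1 ⊗ₜ g1)) ∗ gamma h2)) ∗ gamma g2))); last first.
    by congr (E _); inside_lets 1 (rewrite -gamma_quotientE).
  by sweedler_by (by rewrite amulA_coinvl E_mul sigmaE).
Qed.
End Cleft.

(** * Cleft extensions are crossed products *)

(** The element gamma(1) is coinvariant with inverse delta(1), since alpha, beta
    and eps are 1 at the unit; divide gamma by it on the left and multiply delta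
    by it on the right. *)
Lemma cleft_normalized (k : fieldType) (H : coquasiHopf k) (A : comodAlgebra H) : cleft A ->
  exists gamma delta : {linear H -> A},
    [/\ forall h : H, rho (gamma h) = \sw_(h1, h2 <- h) (gamma h1 ⊗ₜ h2),
        forall h : H, rho (delta h) = \sw_(h1, h2 <- h) (delta h2 ⊗ₜ antipode H h1),
        forall h : H, \sw_(h1, h2 <- h) (delta h1 ∗ gamma h2) = alpha H h *: aone A,
        forall h : H, \sw_(h1, h2, h3 <- h) (beta H h2 *: (gamma h1 ∗ delta h3))
                      = eps h *: aone A
      & gamma (hone H) = aone A].
Proof.
case=> gamma [delta [rho_gamma rho_delta delta_gamma gamma_delta]].
have cP : coinvariant (gamma (hone H)).
  by apply/eqP; rewrite rho_gamma; sweedler.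
have dP : coinvariant (delta (hone H)).
  by apply/eqP; rewrite rho_delta; sweedler_by (by rewrite antipode_one).
pose c := Coinv cP; pose d := Coinv dP.
have cd1 : cval c ∗ cval d = aone A.
  rewrite -[RHS]scale1r -(eps_one H) -gamma_delta; symmetry.
  by sweedler_by (by rewrite beta_one scale1r).
have dc1 : cval d ∗ cval c = aone A.
  rewrite -[RHS]scale1r -(alpha_one H) -delta_gamma; symmetry.
  by sweedler.
have [gamma' gammaE] : exists g : {linear H -> A}, forall h, g h = cval d ∗ gamma h.
  by apply: exists_linear; lin.
have [delta' deltaE] : exists g : {linear H -> A}, forall h, g h = delta h ∗ cval c.
  by apply: exists_linear; lin.
exists gamma', delta'; split=> [h|h|h|h|].
- by rewrite gammaE; sweedler_by (by rewrite gammaE).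
- by rewrite deltaE; sweedler_by (by rewrite deltaE).
- rewrite -delta_gamma; apply: eq_tsum => h1 h2.
  by rewrite gammaE deltaE amulA_coinvm -amulA_coinvl cd1 amul1a.
- transitivity ((cval d ∗ \sw_(h1, h2, h3 <- h) (beta H h2 *: (gamma h1 ∗ delta h3))) ∗ cval c).
    by sweedler_by (by rewrite gammaE deltaE !(amulA_coinvl, amulA_coinvr)).
  by rewrite gamma_delta; sw_scal; rewrite amula1 dc1.
- by rewrite gammaE.
Qed.

Lemma cleft_crossed (k : fieldType) (H : coquasiHopf k) (A : comodAlgebra H) : cleft A ->
  exists (act : {linear (H ⊗ coinv A)%type -> coinv A})
         (sigma : {linear (H ⊗ H)%type -> coinv A}),
    [/\ crossed_system act sigma,
        conv_invertible sigma
      & exists Phi : {linear A -> (coinv A ⊗ H)%type}, crossed_iso act sigma Phi].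
Proof.
case/cleft_normalized=> gamma [delta [rho_gamma rho_delta delta_gamma gamma_delta gamma_one]].
have [E cval_E] := exists_coinv_part rho_delta.
have E_gamma := cleft_E_gamma rho_gamma gamma_delta cval_E.
have gammaE := cleft_gammaE rho_gamma rho_delta delta_gamma cval_E.
have [act actE'] : exists act : {linear (H ⊗ coinv A)%type -> coinv A},
    forall t, act t = \tsum_(h, b <- t) E (gamma h ∗ cval b).
  by apply: exists_linear; lin.
have [sigma sigmaE'] : exists sigma : {linear (H ⊗ H)%type -> coinv A},
    forall t, sigma t = \tsum_(h, g <- t) E (gamma h ∗ gamma g).
  by apply: exists_linear; lin.
have [Phi PhiE] : exists Phi : {linear A -> (coinv A ⊗ H)%type},
    forall a, Phi a = \tsum_(a0, a1 <- rho a) (E a0 ⊗ₜ a1).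
  by apply: exists_linear; lin.
have actE h b : act (h ⊗ₜ b) = E (gamma h ∗ cval b) by rewrite actE' tsum_tensE //; lin.
have sigmaE h g : sigma (h ⊗ₜ g) = E (gamma h ∗ gamma g) by rewrite sigmaE' tsum_tensE //; lin.
exists act, sigma; split.
- exact: (normal_basis_crossed_system rho_gamma gamma_one E_gamma gammaE actE sigmaE).
- exact: (cleft_sigma_invertible rho_gamma rho_delta delta_gamma gamma_delta cval_E sigmaE).
- exists Phi.
  exact: (normal_basis_crossed_iso rho_gamma gamma_one E_gamma gammaE actE sigmaE PhiE).
Qed.

(** * Crossed products are cleft *)

Section Converse.
Variables (k : fieldType) (H : coquasiHopf k) (A : comodAlgebra H).
Local Notation B := (coinv A).
Local Notation S := (antipode H).
Variables (act : {linear (H ⊗ B)%type -> B}) (sigma tau : {linear (H ⊗ H)%type -> B}).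
Hypothesis cs : crossed_system act sigma.
Hypothesis tau_sigma : forall h g : H,
  \sw_(h1, h2 <- h) \sw_(g1, g2 <- g) (tau (h1 ⊗ₜ g1) * sigma (h2 ⊗ₜ g2))
  = (eps h * eps g) *: (1 : B).
Variables (Phi : {linear A -> (B ⊗ H)%type}) (Psi : (B ⊗ H)%type -> A).
Hypothesis isoPhi : crossed_iso act sigma Phi.
Hypothesis PhiK : cancel Phi Psi.
Hypothesis PsiK : cancel Psi Phi.

Lemma inverse_lin : lin Psi.
Proof. by move=> c x y; apply: (can_inj PhiK); rewrite linearP !PsiK. Qed.

Variable gamma : {linear H -> A}.
Hypothesis gammaE : forall h, gamma h = Psi ((1 : B) ⊗ₜ h).

Lemma Phi_coinv_gamma (b : B) h : Phi (cval b ∗ gamma h) = b ⊗ₜ h.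
Proof.
case: isoPhi => _ Phi_scale _ _ _.
rewrite Phi_scale gammaE PsiK /crossed_scale.
by rewrite tsum_tensE; [rewrite mulr1 | lin].
Qed.

Lemma crossed_gamma_one : gamma (hone H) = aone A.
Proof. by case: isoPhi => _ _ _ _ Phi1; apply: (can_inj PhiK); rewrite gammaE PsiK Phi1. Qed.

Lemma crossed_rho_gamma h : rho (gamma h) = \sw_(h1, h2 <- h) (gamma h1 ⊗ₜ h2).
Proof.
have lPsi := inverse_lin.
case: isoPhi => _ _ Phi_rho _ _.
pose f (t : ((B ⊗ H) ⊗ H)%type) := \tsum_(x, g <- t) (Psi x ⊗ₜ g).
have lf : lin f by rewrite /f; lin.
have fE a0 a1 : f (Phi a0 ⊗ₜ a1) = a0 ⊗ₜ a1 by rewrite /f tsum_tensE ?PhiK //; lin.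
have := congr1 f (Phi_rho (gamma h)).
rewrite (lin_tsumE _ _ lf).
rewrite (eq_tsum (fun a0 a1 => fE a0 a1)).
rewrite {1}/tsum -tens_sumE => ->; rewrite gammaE PsiK /crossed_rho /f.
by sweedler_by (by rewrite gammaE).
Qed.

Lemma crossed_gamma_mul h g : gamma h ∗ gamma g =
  \sw_(h1, h2 <- h) \sw_(g1, g2 <- g) (cval (sigma (h1 ⊗ₜ g1)) ∗ gamma (h2 ∙ g2)).
Proof.
case: isoPhi => _ _ _ Phi_mul _; apply: (can_inj PhiK).
rewrite Phi_mul !gammaE !PsiK /crossed_mul.
rewrite tsum_tensE; last by sw_unfold; lin.
rewrite tsum_tensE; last by sw_unfold; lin.
transitivity (\sw_(h1, h2 <- h) \sw_(g1, g2 <- g) (sigma (h1 ⊗ₜ g1) ⊗ₜ (h2 ∙ g2))).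
  by sweedler_by_using ltac:(by sw_scal; rewrite ?mul1r) ltac:(rewrite (act_one cs)).
by sweedler_by (by rewrite Phi_coinv_gamma).
Qed.

Variable delta : {linear H -> A}.
Hypothesis deltaE : forall h, delta h =
  \sw_(h1, h2, x <- h) \sw_(h3, h4 <- x)
    (alpha H h3 *: (cval (tau (S h2 ⊗ₜ h4)) ∗ gamma (S h1))).

Lemma crossed_rho_delta h : rho (delta h) = \sw_(h1, h2 <- h) (delta h2 ⊗ₜ S h1).
Proof.
have rho_gamma := crossed_rho_gamma.
rewrite deltaE; symmetry; inside (rewrite deltaE).
by sweedler.
Qed.

(** Expanding gamma(S(h_1)) gamma(h_5) produces sigma next to tau, on arguments
    which are the coproducts of S(q) and r; they cancel and leave
    S(h_1) alpha(h_2) h_3 as argument of gamma. *)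
Lemma crossed_delta_gamma h :
  \sw_(h1, h2 <- h) (delta h1 ∗ gamma h2) = alpha H h *: aone A.
Proof.
inside_lets 1 (rewrite deltaE).
transitivity (\sw_(h1, h2, x <- h) \sw_(h3, h4, h5 <- x)
    (alpha H h3 *: (cval (tau (S h2 ⊗ₜ h4)) ∗ (gamma (S h1) ∗ gamma h5)))).
  by sweedler_by (by sw_scal; rewrite amulA_coinvl).
inside (rewrite crossed_gamma_mul).
transitivity (\sw_(a, q, b, r, c <- h)
  (alpha H b *: (cval (\sw_(h1, h2 <- S q) \sw_(g1, g2 <- r)
     (tau (h1 ⊗ₜ g1) * sigma (h2 ⊗ₜ g2))) ∗ gamma (S a ∙ c)))).
  by sweedler_by (by sw_scal; rewrite ?cvalM amulA_coinvl).
inside (rewrite tau_sigma).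
transitivity (gamma (\sw_(a, b, c <- h) (alpha H b *: (S a ∙ c)))).
  by sweedler_by (by sw_scal; rewrite ?cval1 amul1a).
by rewrite antipode_alpha linear_scale crossed_gamma_one.
Qed.

(** The left-hand side is the coinvariant part of gamma(h), and
    [coinv_part_gamma] expands gamma(h) with these coinvariants as coordinates.
    Since 1 (x) h is the image of gamma(h) under Phi, they are eps(h) 1. *)
Lemma crossed_gamma_delta h :
  \sw_(h1, h2, h3 <- h) (beta H h2 *: (gamma h1 ∗ delta h3)) = eps h *: aone A.
Proof.
have rho_gamma := crossed_rho_gamma.
have rho_delta := crossed_rho_delta.
have [E cval_E] := exists_coinv_part rho_delta.
transitivity (cval (E (gamma h))).
  by rewrite cval_E /coinv_part; sweedler.
suff -> : E (gamma h) = eps h *: (1 : B) by [].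
have F : \sw_(h1, h2 <- h) (E (gamma h1) ⊗ₜ h2) = (1 : B) ⊗ₜ h.
  transitivity (Phi (\sw_(h1, h2 <- h) (cval (E (gamma h1)) ∗ gamma h2))).
    by sweedler_by (by rewrite Phi_coinv_gamma).
  rewrite -Phi_coinv_gamma cval1 amul1a; congr (Phi _).
  rewrite -[RHS](coinv_part_gamma rho_gamma rho_delta crossed_delta_gamma).
  transitivity (\tsum_(a0, a1 <- rho (gamma h)) (cval (E a0) ∗ gamma a1)).
    by rewrite rho_gamma; sweedler.
  by apply: eq_tsum => a0 a1; rewrite cval_E.
have := congr1 (tsum (fun b g => eps g *: b)) F.
rewrite tsum_tensE; last by lin.
by move=> <-; sweedler.
Qed.
End Converse.

Theorem theorem33 (k : fieldType) (H : coquasiHopf k) (A : comodAlgebra H) :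
  cleft A <->
  exists (act : {linear (H ⊗ coinv A)%type -> coinv A})
         (sigma : {linear (H ⊗ H)%type -> coinv A}),
    [/\ crossed_system act sigma,
        conv_invertible sigma
      & exists Phi : {linear A -> (coinv A ⊗ H)%type}, crossed_iso act sigma Phi].
Proof.
split=> [|[act [sigma [cs [tau [_ tau_sigma]] [Phi isoPhi]]]]]; first exact: cleft_crossed.
have [[Psi PhiK PsiK] _ _ _ _] := isoPhi.
have lPsi := inverse_lin PhiK PsiK.
have [gamma gammaE] : exists gamma : {linear H -> A}, forall h, gamma h = Psi ((1 : coinv A) ⊗ₜ h).
  by apply: exists_linear; lin.
have [delta deltaE] : exists delta : {linear H -> A}, forall h, delta h =
    \sw_(h1, h2, x <- h) \sw_(h3, h4 <- x)
      (alpha H h3 *: (cval (tau (antipode H h2 ⊗ₜ h4)) ∗ gamma (antipode H h1))).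
  by apply: exists_linear; sw_unfold; lin.
exists gamma, delta; split.
- exact: (crossed_rho_gamma isoPhi PhiK PsiK gammaE).
- exact: (crossed_rho_delta isoPhi PhiK PsiK gammaE deltaE).
- exact: (crossed_delta_gamma cs tau_sigma isoPhi PhiK PsiK gammaE deltaE).
- exact: (crossed_gamma_delta cs tau_sigma isoPhi PhiK PsiK gammaE deltaE).
Qed.
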